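(* Let $A$ be a function ring over $\mathbb{F}_q$, given as $A=\mathbb{F}_q[T_1,\dots,T_m]/(P)$ for some polynomial $P$, and let $g_k\in A$ be the class of $T_k$ for $1\leqslant k\leqslant m$. Let $(K,\gamma)$ be an $A$-field with $K$ finite, let $\phi$ be a Drinfeld $A$-module over $(K,\gamma)$, and let $u\in K\{\tau\}$ be a morphism of Drinfeld $A$-modules whose domain is $\phi$. Let $d_u=\dim_{\mathbb{F}_q}(\ker_K(u))$, fix an $\mathbb{F}_q$-basis $(b_1,\dots,b_{d_u})$ of $\ker_K(u)$, and for $1\leqslant k\leqslant m$ let $M_k\in\mathbb{F}_q^{d_u\times d_u}$ be the matrix of the $\mathbb{F}_q$-linear endomorphism $\phi_{g_k}$ of $\ker_K(u)$, whose $j$-th row consists of the coordinates of $\phi_{g_k}(b_j)$. Let $M_\chi$ be the matrix with entries in $A$, with $m d_u$ rows and $d_u$ columns, obtained by stacking vertically the blocks $g_k\,\mathrm{Id}-M_k$, $1\leqslant k\leqslant m$. Then there is an isomorphism of $A$-modules \[ \phi(\ker_K(u))\simeq A^{d_u}/\mathrm{Im}(M_\chi), \] where $\mathrm{Im}(M_\chi)\subset A^{d_u}$ is the submodule generated by the rows of $M_\chi$. Moreover, letting $\mathrm{Fitt}_i$ be the ideal of $A$ generated by the $(d_u-i)\times(d_u-i)$ minors of $M_\chi$ for $0\leqslant i\leqslant d_u$, the ideals \[ \mathfrak d_i=\frac{\mathrm{Fitt}_{d_u-i}}{\mathrm{Fitt}_{d_u+1-i}},\qquad 1\leqslant i\leqslant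 d_u, \] are the invariant factors of $\phi(\ker_K(u))$ (where unit ideals are allowed at the beginning of the chain).
   Context: A function ring: let $C$ be a smooth projective geometrically connected curve over $\mathbb{F}_q$ with a closed point $\infty$; $A$ is the ring of functions in $\mathbb{F}_q(C)$ regular outside $\infty$. It is a Dedekind domain and a finitely generated $\mathbb{F}_q$-algebra. An $A$-field $(K,\gamma)$ is a field extension $K/\mathbb{F}_q$ with a morphism of $\mathbb{F}_q$-algebras $\gamma:A\to K$. $\tau$ is the Frobenius $x\mapsto x^q$ on an algebraic closure $\overline K$; $K\{\tau\}$ is the $\mathbb{F}_q$-algebra of Ore polynomials $\sum_{i=0}^n x_i\tau^i$ ($x_i\in K$), with addition and composition of endomorphisms of $\overline K$. A Drinfeld $A$-module over $(K,\gamma)$ is a morphism of $\mathbb{F}_q$-algebras $\phi:A\to K\{\tau\}$, $a\mapsto\phi_a$, with image not contained in $K$ and such that the constant coefficient of $\phi_a$ is $\gamma(a)$ for all $a\in A$. A morphism $u:\phi\to\psi$ of Drinfeld $A$-modules over $(K,\gamma)$ is $u\in K\{\tau\}$ with $u\phi_a=\psi_au$ for all $a\in A$. Put $\ker_K(u)=\ker(u)\cap K$; $\phi(\ker_K(u))$ is $\ker_K(u)$ viewed as an $A$-module via $a\cdot z=\phi_a(z)$. The invariant factors of a finite $A$-module $W$ are the unique chain of ideals $\mathfrak d_1\mid\cdots\mid\mathfrak d_\ell$ of $A$ with $W\simeq\prod_i A/\mathfrak d_i$ (uniqueness being up to unit ideals at the beginning of the chain). The $0\times0$ minor is $1$, so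 $\mathrm{Fitt}_{d_u}=A$. The quotient of two nonzero ideals is taken in the group of fractional ideals of $A$. *)

(* Defs.v *)
(* [boolp] is used only to decide membership in submodules when forming
   quotient modules. *)
From HB Require Import structures.
From mathcomp Require Import all_boot all_order all_algebra all_field.
From mathcomp Require Import boolp.
From mathcomp Require Export mpoly.

Set Implicit Arguments.
Unset Strict Implicit.
Unset Printing Implicit Defensive.

Import GRing.Theory.
Local Open Scope ring_scope.
Local Open Scope quotient_scope.

Section Submodules.
Variable A : comNzRingType.

Record submod (V : lmodType A) := Submod {
  in_submod :> V -> Prop;
  submod0 : in_submod 0;
  submodD : forall v w, in_submod v -> in_submod w -> in_submod (v + w);
  submodZ : forall a v, in_submod v -> in_submod (a *: v) }.

Definition submod_pred (V : lmodType A) (N : submod V) : {pred V} :=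
  fun v => `[< N v >].

Section Quotient.
Variables (V : lmodType A) (N : submod V).

Fact submod_pred_zmod : zmod_closed (submod_pred N).
Proof.
split=> [|v w]; first exact/asboolP/submod0.
move=> /asboolP Nv /asboolP Nw; apply/asboolP/submodD => //.
by rewrite -scaleN1r; apply: submodZ.
Qed.

HB.instance Definition _ :=
  GRing.isZmodClosed.Build V (submod_pred N) submod_pred_zmod.

Definition quot_mod := Quotient.quot (submod_pred N).
HB.instance Definition _ := GRing.Zmodule.on quot_mod.

Definition quot_proj (v : V) : quot_mod := \pi_(Quotient.quot (submod_pred N)) v.

Definition quot_scale (a : A) (x : quot_mod) : quot_mod :=
  quot_proj (a *: repr x).

Lemma quot_projP v w : quot_proj v = quot_proj w <-> N (v - w).
Proof.
split=> [/eqP|Nvw].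
  by rewrite -Quotient.idealrBE => /asboolP.
by apply/eqP; rewrite -Quotient.idealrBE; apply/asboolP.
Qed.

Lemma quot_proj_surj x : exists v, quot_proj v = x.
Proof. by exists (repr x); rewrite /quot_proj reprK. Qed.

Lemma quot_projD v w : quot_proj (v + w) = quot_proj v + quot_proj w.
Proof. by rewrite /quot_proj !piE. Qed.

Lemma quot_projZ a v : quot_proj (a *: v) = quot_scale a (quot_proj v).
Proof.
apply/quot_projP; rewrite -scalerBr; apply: submodZ; apply/quot_projP.
by rewrite {2}/quot_proj reprK.
Qed.

Fact quot_scaleA a b x : quot_scale a (quot_scale b x) = quot_scale (a * b) x.
Proof. by have [v <-] := quot_proj_surj x; rewrite -!quot_projZ scalerA. Qed.
Fact quot_scale1 : left_id 1 quot_scale.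
Proof. by move=> x; have [v <-] := quot_proj_surj x; rewrite -quot_projZ scale1r. Qed.
Fact quot_scaleDr : right_distributive quot_scale +%R.
Proof.
move=> a x y; have [v <-] := quot_proj_surj x; have [w <-] := quot_proj_surj y.
by rewrite -quot_projD -!quot_projZ scalerDr quot_projD.
Qed.
Fact quot_scaleDl x : {morph quot_scale^~ x : a b / a + b}.
Proof.
move=> a b; have [v <-] := quot_proj_surj x.
by rewrite -!quot_projZ scalerDl quot_projD.
Qed.

HB.instance Definition _ := GRing.Zmodule_isLmodule.Build A quot_mod
  quot_scaleA quot_scale1 quot_scaleDr quot_scaleDl.

End Quotient.

Section Span.
Variables (V : lmodType A) (S : V -> Prop).

Definition in_span (v : V) : Prop := exists (s : seq (A * V)),
  (forall t, t \in s -> S t.2) /\ v = \sum_(t <- s) t.1 *: t.2.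

Fact in_span0 : in_span 0.
Proof. by exists [::]; split=> //; rewrite big_nil. Qed.
Fact in_spanD v w : in_span v -> in_span w -> in_span (v + w).
Proof.
move=> [s [Ss ->]] [r [Sr ->]]; exists (s ++ r); split; last by rewrite big_cat.
by move=> t; rewrite mem_cat => /orP[/Ss|/Sr].
Qed.
Fact in_spanZ a v : in_span v -> in_span (a *: v).
Proof.
move=> [s [Ss ->]]; exists [seq (a * t.1, t.2) | t <- s]; split.
  by move=> _ /mapP[t /Ss St ->].
by rewrite big_map scaler_sumr; apply: eq_bigr => t _; rewrite scalerA.
Qed.

Definition span_submod : submod V := Submod in_span0 in_spanD in_spanZ.

End Span.

Section Product.
Variables (I : finType) (V : I -> lmodType A).

Definition prod_mod := {dffun forall i, V i}.
HB.instance Definition _ := Choice.on prod_mod.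

Implicit Types f g : prod_mod.
Definition prod_zero : prod_mod := [ffun i => 0].
Definition prod_opp f : prod_mod := [ffun i => - f i].
Definition prod_add f g : prod_mod := [ffun i => f i + g i].
Definition prod_scale a f : prod_mod := [ffun i => a *: f i].

Fact prod_addA : associative prod_add.
Proof. by move=> f g h; apply/ffunP=> i; rewrite !ffunE addrA. Qed.
Fact prod_addC : commutative prod_add.
Proof. by move=> f g; apply/ffunP=> i; rewrite !ffunE addrC. Qed.
Fact prod_add0 : left_id prod_zero prod_add.
Proof. by move=> f; apply/ffunP=> i; rewrite !ffunE add0r. Qed.
Fact prod_addN : left_inverse prod_zero prod_opp prod_add.
Proof. by move=> f; apply/ffunP=> i; rewrite !ffunE addNr. Qed.
HB.instance Definition _ := GRing.isZmodule.Build prod_mod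
  prod_addA prod_addC prod_add0 prod_addN.

Fact prod_scaleA a b f : prod_scale a (prod_scale b f) = prod_scale (a * b) f.
Proof. by apply/ffunP=> i; rewrite !ffunE scalerA. Qed.
Fact prod_scale1 : left_id 1 prod_scale.
Proof. by move=> f; apply/ffunP=> i; rewrite !ffunE scale1r. Qed.
Fact prod_scaleDr : right_distributive prod_scale +%R.
Proof. by move=> a f g; apply/ffunP=> i; rewrite !ffunE scalerDr. Qed.
Fact prod_scaleDl f : {morph prod_scale^~ f : a b / a + b}.
Proof. by move=> a b; apply/ffunP=> i; rewrite !ffunE scalerDl. Qed.
HB.instance Definition _ := GRing.Zmodule_isLmodule.Build A prod_mod
  prod_scaleA prod_scale1 prod_scaleDr prod_scaleDl.

End Product.

Definition lmod_iso (V W : lmodType A) : Prop :=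
  exists f : {linear V -> W}, bijective f.

Definition ideal := submod A^o.

Definition ideal_mul (I J : ideal) : ideal :=
  span_submod (V := A^o) (fun x => exists a b, [/\ I a, J b & x = a * b]).

Definition ideal_dvd (I J : ideal) : Prop :=
  exists C : ideal, forall x, J x <-> ideal_mul I C x.

(* Unit ideals are allowed at the beginning of the chain. *)
Definition invariant_factors (W : lmodType A) (l : nat) (D : 'I_l -> ideal) :=
  (forall i i' : 'I_l, (i <= i')%N -> ideal_dvd (D i) (D i')) /\
  lmod_iso W (prod_mod (fun i : 'I_l => quot_mod (D i) : lmodType A)).

Definition row_submod (r d : nat) (M : 'M[A]_(r, d)) : submod 'rV[A]_d :=
  span_submod (fun v => exists i, v = row i M).

Definition is_minor (r d n : nat) (M : 'M[A]_(r, d)) (x : A) : Prop :=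
  exists (f : 'I_n -> 'I_r) (h : 'I_n -> 'I_d),
    [/\ {homo f : i i' / (i < i')%N}, {homo h : i i' / (i < i')%N}
      & x = \det (mxsub f h M)].

Definition fitting (r d : nat) (M : 'M[A]_(r, d)) (i : nat) : ideal :=
  span_submod (V := A^o) (is_minor (d - i) M).

(* Products of fractional ideals, taken in a field F containing A via j; the
   inverse of J in the group of fractional ideals is {x | x J ⊆ A}. *)
Section FractionalIdeals.
Variables (F : fieldType) (j : {rmorphism A -> F}).

Definition frac_of (I : ideal) (x : F) : Prop := exists2 a, I a & x = j a.

Definition frac_inv (J : ideal) (x : F) : Prop :=
  forall b, J b -> exists a, x * j b = j a.

Definition frac_quot (I J : ideal) (x : F) : Prop :=
  exists s : seq (A * F),
    (forall t, t \in s -> I t.1 /\ frac_inv J t.2) /\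
    x = \sum_(t <- s) j t.1 * t.2.

End FractionalIdeals.

End Submodules.

(* A smooth projective geometrically connected curve C over Fq is encoded by
   its function field F = Fq(C): a finitely generated extension of
   transcendence degree 1 in which Fq is algebraically closed. The closed
   points of C are the valuation rings Fq ⊆ O ⊊ F of F; O is then the local
   ring at the point, i.e. the ring of functions regular there. *)
Section Curves.
Variables (Fq : finFieldType) (F : fieldType) (iota : {rmorphism Fq -> F}).

Definition in_ratfield (x y : F) : Prop :=
  exists p r : {poly Fq},
    (map_poly iota r).[x] != 0 /\ y = (map_poly iota p).[x] / (map_poly iota r).[x].

Definition algebraic_over_const (x : F) : Prop :=
  exists2 p : {poly Fq}, p != 0 & root (map_poly iota p) x.

Definition function_field : Prop :=
  (exists x : F, ~ algebraic_over_const x /\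
     exists (n : nat) (e : 'I_n -> F), forall y : F,
       exists c : 'I_n -> F,
         (forall i, in_ratfield x (c i)) /\ y = \sum_i c i * e i) /\
  (forall x : F, algebraic_over_const x -> exists c, x = iota c).

Definition closed_point (O : F -> Prop) : Prop :=
  [/\ forall c, O (iota c),
      forall x y, O x -> O y -> O (x - y) /\ O (x * y),
      exists x, ~ O x
    & forall x, x != 0 -> O x \/ O x^-1].

Definition regular_outside (Oinf : F -> Prop) (x : F) : Prop :=
  forall O : F -> Prop,
    closed_point O -> ~ (forall y, O y <-> Oinf y) -> O x.

(* j identifies the Fq-algebra A with the ring of functions regular outside
   the point Oinf. *)
Definition function_ring (Oinf : F -> Prop) (A : comAlgType Fq)
    (j : {rmorphism A -> F}) : Prop :=
  [/\ injective j, forall c, j c%:A = iota c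
    & forall x, (exists a, j a = x) <-> regular_outside Oinf x].

End Curves.

(* pi induces an isomorphism Fq[T_1, .., T_m] / (P) ~= A. *)
Definition presentation (Fq : finFieldType) (A : comAlgType Fq) (m : nat)
    (P : {mpoly Fq[m]}) (pi : {lrmorphism {mpoly Fq[m]} -> A}) : Prop :=
  (forall a, exists p, pi p = a) /\
  (forall p, pi p = 0 <-> exists h, p = h * P).

Lemma pchar_nat_card (Fq : finFieldType) (R : comNzRingType)
    (f : {rmorphism Fq -> R}) i : [pchar R].-nat (#|Fq| ^ i)%N.
Proof.
have [p p_pr pF] := finPcharP Fq.
have pR : p \in [pchar R] by apply: (rmorph_pchar f).
rewrite (card_pprimeChar pF) -expnM pnatX.
by rewrite /pnat prime_gt0 //= primes_prime //= pR.
Qed.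

Section FrobeniusPowers.
Variables (Fq : finFieldType) (R : comNzRingType) (f : {rmorphism Fq -> R}).
Local Notation q := #|Fq|.

Lemma expqD i (x y : R) : (x + y) ^+ (q ^ i) = x ^+ (q ^ i) + y ^+ (q ^ i).
Proof. exact/exprDn_pchar/(pchar_nat_card f). Qed.

Lemma expq0 i : 0 ^+ (q ^ i) = 0 :> R.
Proof. by rewrite expr0n expn_eq0 -leqn0 leqNgt (ltnW (finNzRing_gt1 Fq)). Qed.

Lemma expq_sum i (I : Type) (r : seq I) (P : pred I) (G : I -> R) :
  (\sum_(k <- r | P k) G k) ^+ (q ^ i) = \sum_(k <- r | P k) G k ^+ (q ^ i).
Proof.
apply: (big_morph (fun x => x ^+ (q ^ i))); [exact: expqD | exact: expq0].
Qed.

Lemma expqC i c : f c ^+ (q ^ i) = f c.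
Proof.
by elim: i => [|i IHi]; rewrite ?expr1 // expnSr exprM IHi -rmorphXn expf_card.
Qed.

End FrobeniusPowers.

Lemma sum_ord_shift (V : nmodType) (n k : nat) (G : nat -> V) : (k <= n)%N ->
  \sum_(i < n | (k <= i)%N) G (i - k)%N = \sum_(i < n - k) G i.
Proof.
move=> le_kn; rewrite -(big_mkord (fun i => k <= i)%N (fun i => G (i - k)%N)).
rewrite (big_cat_nat (leq0n k) le_kn) /= big_nat_cond big_pred0 ?add0r => [|i].
  rewrite -[X in \sum_(X <= _ < _ | _) _]add0n big_addn big_mkord.
  by apply: eq_big => i; rewrite ?leq_addl // => _; rewrite addnK.
by rewrite /=; case: ltnP; rewrite ?andbF.
Qed.

(* The Ore polynomial \sum_i x_i tau^i is stored as the polynomial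
   \sum_i x_i 'X^i, but with the multiplication determined by
   tau x = x^q tau; see ore_evalM and ore_eval_inj below. *)
Section OreRing.
Variables (Fq : finFieldType) (K : fieldExtType Fq).
Local Notation q := #|Fq|.

Definition ore : Type := {poly K}.
HB.instance Definition _ := GRing.Zmodule.on ore.

Implicit Types u v w : ore.

Definition ore_coef u i : K := (u : {poly K})`_i.
Definition ore_size u : nat := size (u : {poly K}).
Definition oreC (c : K) : ore := c%:P.

Definition ore_mul u v : ore :=
  \poly_(i < ore_size u + ore_size v)
     \sum_(k < i.+1) ore_coef u k * ore_coef v (i - k) ^+ (q ^ k).

Lemma oreP u v : ore_coef u =1 ore_coef v -> u = v.
Proof. by move=> uv; apply/polyP. Qed.

Lemma ore_coefD u v i : ore_coef (u + v) i = ore_coef u i + ore_coef v i.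
Proof. exact: coefD. Qed.

Lemma ore_coef0 i : ore_coef 0 i = 0.
Proof. exact: coef0. Qed.

Lemma ore_coefC c i : ore_coef (oreC c) i = if i == 0%N then c else 0.
Proof. exact: coefC. Qed.

Lemma ore_coef_default u i : (ore_size u <= i)%N -> ore_coef u i = 0.
Proof. exact: nth_default. Qed.

Lemma ore_coefM u v i : ore_coef (ore_mul u v) i =
  \sum_(k < i.+1) ore_coef u k * ore_coef v (i - k) ^+ (q ^ k).
Proof.
rewrite /ore_coef coef_poly; case: ltnP => // le_i.
rewrite big1 // => k _; have [u_k|k_u] := leqP (ore_size u) k.
  by rewrite -/(ore_coef u k) ore_coef_default ?mul0r.
have le_vi : (ore_size v + k <= i)%N.
  by apply: leq_trans le_i; rewrite addnC leq_add2r ltnW.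
have le_v : (ore_size v <= i - k)%N by rewrite -(addnK k (ore_size v)) leq_sub2r.
by rewrite -/(ore_coef v _) (ore_coef_default le_v) expq0 mulr0.
Qed.

Fact ore_mulA : associative ore_mul.
Proof.
move=> u v w; apply: oreP => i; rewrite !ore_coefM.
pose coef3 k l := ore_coef u k *
  (ore_coef v l * ore_coef w (i - k - l) ^+ (q ^ l)) ^+ (q ^ k).
transitivity (\sum_(k < i.+1) \sum_(l < i.+1 | (l <= i - k)%N) coef3 k l).
  apply: eq_bigr => /= k _; rewrite ore_coefM.
  rewrite (expq_sum (in_alg K)) big_distrr /=.
  by rewrite (big_ord_narrow_leq (leq_subr _ _)).
transitivity (\sum_(n < i.+1) \sum_(k < i.+1 | (k <= n)%N) coef3 k (n - k)%N);
    last first.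
  apply: eq_bigr => n _; rewrite ore_coefM big_distrl /=.
  rewrite (big_ord_narrow_leq (leq_ord n)) /=; apply: eq_bigr => k _.
  have le_kn : (k <= n)%N by rewrite -ltnS ltn_ord.
  by rewrite /coef3 exprMn -exprM -expnD subnK // mulrA -subnDA subnKC.
rewrite [RHS](exchange_big_dep predT) //=; apply: eq_bigr => k _.
have le_ki := leq_ord k.
rewrite (sum_ord_shift (coef3 k) (leqW le_ki)) subSn //.
by rewrite (big_ord_narrow_leq (leq_subr _ _)).
Qed.

Fact ore_mul1 : left_id (oreC 1) ore_mul.
Proof.
move=> u; apply: oreP => i; rewrite ore_coefM big_ord_recl subn0.
rewrite big1 => [|k _]; last by rewrite ore_coefC mul0r.
by rewrite ore_coefC mul1r expn0 expr1 addr0.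
Qed.

Fact ore_mulr1 : right_id (oreC 1) ore_mul.
Proof.
move=> u; apply: oreP => i; rewrite ore_coefM big_ord_recr /= subnn.
rewrite big1 => [|k _].
  by rewrite ore_coefC eqxx expr1n mulr1 add0r.
by rewrite ore_coefC subn_eq0 leqNgt ltn_ord expq0 mulr0.
Qed.

Fact ore_mulDl : left_distributive ore_mul +%R.
Proof.
move=> u v w; apply: oreP => i; rewrite ore_coefD !ore_coefM -big_split.
by apply: eq_bigr => k _; rewrite ore_coefD mulrDl.
Qed.

Fact ore_mulDr : right_distributive ore_mul +%R.
Proof.
move=> u v w; apply: oreP => i; rewrite ore_coefD !ore_coefM -big_split.
by apply: eq_bigr => k _; rewrite ore_coefD (expqD (in_alg K)) mulrDr.
Qed.

Fact ore1_neq0 : oreC 1 != 0.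
Proof. by rewrite polyC_eq0 oner_neq0. Qed.

HB.instance Definition _ := GRing.Zmodule_isNzRing.Build ore
  ore_mulA ore_mul1 ore_mulr1 ore_mulDl ore_mulDr ore1_neq0.

Definition ore_scale (c : Fq) u : ore := oreC c%:A * u.

Lemma ore_coefCM c u i : ore_coef (oreC c * u) i = c * ore_coef u i.
Proof.
rewrite ore_coefM big_ord_recl subn0 big1 => [|k _].
  by rewrite ore_coefC expn0 expr1 addr0.
by rewrite ore_coefC mul0r.
Qed.

Fact ore_scaleA a b u : ore_scale a (ore_scale b u) = ore_scale (a * b) u.
Proof.
by apply: oreP => i; rewrite !ore_coefCM mulrA -!in_algE -rmorphM.
Qed.
Fact ore_scale1 : left_id 1 ore_scale.
Proof. by move=> u; apply: oreP => i; rewrite ore_coefCM scale1r mul1r. Qed.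
Fact ore_scaleDr : right_distributive ore_scale +%R.
Proof. by move=> a u v; exact: mulrDr. Qed.
Fact ore_scaleDl u : {morph ore_scale^~ u : a b / a + b}.
Proof.
by move=> a b; apply: oreP => i; rewrite ore_coefD !ore_coefCM -mulrDl -scalerDl.
Qed.
HB.instance Definition _ := GRing.Zmodule_isLmodule.Build Fq ore
  ore_scaleA ore_scale1 ore_scaleDr ore_scaleDl.

Fact ore_scaleAl a u v : a *: (u * v) = (a *: u) * v.
Proof. exact: mulrA. Qed.
HB.instance Definition _ := GRing.Lmodule_isLalgebra.Build Fq ore ore_scaleAl.

Fact ore_scaleAr a u v : a *: (u * v) = u * (a *: v).
Proof.
suff comm_a : oreC a%:A * u = u * oreC a%:A.
  by rewrite /GRing.scale /= /ore_scale mulrA comm_a mulrA.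
apply: oreP => i; rewrite ore_coefCM ore_coefM big_ord_recr /= subnn.
rewrite big1 => [|k _]; last first.
  by rewrite ore_coefC subn_eq0 leqNgt ltn_ord expq0 mulr0.
by rewrite ore_coefC eqxx add0r -in_algE expqC mulrC.
Qed.
HB.instance Definition _ := GRing.Lalgebra_isAlgebra.Build Fq ore ore_scaleAr.

Section Eval.
Variables (L : fieldType) (f : {rmorphism K -> L}).

(* The endomorphism of an extension L of K defined by u. *)
Definition ore_eval_in u (x : L) : L :=
  \sum_(i < ore_size u) f (ore_coef u i) * x ^+ (q ^ i).

Lemma ore_eval_in_wide n u x : (ore_size u <= n)%N ->
  ore_eval_in u x = \sum_(i < n) f (ore_coef u i) * x ^+ (q ^ i).
Proof.
move=> le_un; rewrite /ore_eval_in.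
rewrite (big_ord_widen n (fun i => f (ore_coef u i) * x ^+ (q ^ i))) //.
rewrite big_mkcond; apply: eq_bigr => i _; case: ltnP => // le_ui.
by rewrite ore_coef_default ?rmorph0 ?mul0r.
Qed.

Lemma ore_evalD u v x : ore_eval_in (u + v) x = ore_eval_in u x + ore_eval_in v x.
Proof.
pose n := maxn (ore_size u) (ore_size v).
rewrite !(@ore_eval_in_wide n) ?leq_maxl ?leq_maxr ?size_polyD //.
by rewrite -big_split; apply: eq_bigr => i _; rewrite ore_coefD rmorphD mulrDl.
Qed.

Lemma ore_evalC c x : ore_eval_in (oreC c) x = f c * x.
Proof.
rewrite (@ore_eval_in_wide 1 _ _ (size_polyC_leq1 c)) big_ord1.
by rewrite ore_coefC expn0 expr1.
Qed.

Lemma ore_evalM u v x : ore_eval_in (u * v) x = ore_eval_in u (ore_eval_in v x).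
Proof.
pose n := (ore_size u + ore_size v)%N.
rewrite (@ore_eval_in_wide n) ?size_poly //.
rewrite (@ore_eval_in_wide n u) ?leq_addr //.
pose t k l := f (ore_coef u k) *
  (f (ore_coef v l) * x ^+ (q ^ l)) ^+ (q ^ k).
transitivity (\sum_(i < n) \sum_(k < n | (k <= i)%N) t k (i - k)%N).
  apply: eq_bigr => i _; rewrite ore_coefM rmorph_sum mulr_suml.
  rewrite -(big_mkord (fun k => k <= i)%N (fun k => t k (i - k)%N)).
  rewrite -(big_mkord xpredT (fun k =>
    f (ore_coef u k * ore_coef v (i - k) ^+ (q ^ k)) * x ^+ (q ^ i))).
  rewrite [RHS](big_cat_nat (n := i.+1)) //= [X in _ + X]big_nat_cond.
  rewrite [X in _ + X]big_pred0 ?addr0 => [|k]; last first.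
    by rewrite /=; case: (ltnP i k); rewrite ?andbF ?andbT.
  rewrite big_nat [RHS]big_nat_cond.
  apply: eq_big => k; first by rewrite ltnS; case: (k <= i)%N; rewrite ?andbF.
  rewrite ltnS => /= le_ki.
  rewrite /t exprMn -exprM -expnD subnK // rmorphM rmorphXn mulrA //.
rewrite (exchange_big_dep predT) //=; apply: eq_bigr => k _.
rewrite (sum_ord_shift (t k) (ltnW (ltn_ord k))) -big_distrr /=.
have [u_k|k_u] := leqP (ore_size u) k.
  by rewrite ore_coef_default // rmorph0 !mul0r.
rewrite -(expq_sum (f \o in_alg K)) -ore_eval_in_wide //.
by rewrite -(addKn k (ore_size v)) leq_sub2r // leq_add2r ltnW.
Qed.

Lemma ore_evalB u v x : ore_eval_in (u - v) x = ore_eval_in u x - ore_eval_in v x.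
Proof. by apply/eqP; rewrite eq_sym subr_eq -ore_evalD subrK. Qed.

Lemma ore_eval_in_is_add u : zmod_morphism (ore_eval_in u).
Proof.
move=> x y; rewrite -sumrB; apply: eq_bigr => i _.
rewrite (expqD (f \o in_alg K)) -[- y]mulN1r exprMn.
have := expqC (f \o in_alg K) i (-1); rewrite rmorphN1 => ->.
by rewrite mulN1r mulrBr.
Qed.

End Eval.

Lemma ore_eval_inj (L : closedFieldType) (f : {rmorphism K -> L}) u v :
  (forall x, ore_eval_in f u x = ore_eval_in f v x) -> u = v.
Proof.
move=> eq_uv; pose w := u - v.
have w0 x : ore_eval_in f w x = 0 by rewrite ore_evalB eq_uv subrr.
pose P : {poly L} := \sum_(i < ore_size w) f (ore_coef w i) *: 'X^(q ^ i).
have P0 : P = 0.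
  apply/eqP/negPn/negP => /closed_nonrootP[x /negP[]].
  rewrite /root -(w0 x) horner_sum; apply/eqP/eq_bigr => i _.
  by rewrite hornerZ hornerXn.
apply/eqP; rewrite -subr_eq0; apply/eqP/oreP => i; rewrite ore_coef0 -/w.
have [?|lt_iw] := leqP (ore_size w) i; first exact: ore_coef_default.
apply: (fmorph_inj f); rewrite rmorph0 -(coef0 L (q ^ i)%N) -P0 coef_sum.
rewrite (bigD1 (Ordinal lt_iw)) //= coefZ coefXn eqxx mulr1 big1 ?addr0 //.
move=> j ne_ji; rewrite coefZ coefXn eqn_exp2l ?finNzRing_gt1 // eq_sym.
by rewrite -[_ == i]/(j == Ordinal lt_iw) (negPf ne_ji) mulr0.
Qed.

Definition ore_eval u : K -> K := ore_eval_in idfun u.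

Fact ore_eval_is_linear u : linear (ore_eval u).
Proof.
move=> c x y; rewrite /ore_eval -{1}[y]opprK ore_eval_in_is_add.
rewrite -[- y]sub0r ore_eval_in_is_add.
have ev0 : ore_eval_in idfun u 0 = 0.
  by rewrite -{1}(subrr 0) ore_eval_in_is_add subrr.
rewrite ev0 sub0r opprK; congr (_ + _); rewrite scaler_sumr.
apply: eq_bigr => i _; rewrite -mulr_algl exprMn.
have -> : (c%:A : K) ^+ (q ^ i) = c%:A by exact: (expqC (in_alg K)).
by rewrite mulrCA mulr_algl.
Qed.
HB.instance Definition _ u :=
  GRing.isLinear.Build Fq K K *:%R (ore_eval u) (ore_eval_is_linear u).

(* K is identified with its image in its algebraic closure, so that
   ker(u) ∩ K is the kernel of the restriction of u to K. *)
Definition kerK u : {vspace K} := lker (linfun (ore_eval u)).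

Lemma mem_kerK u x : (x \in kerK u) = (ore_eval u x == 0).
Proof. by rewrite memv_ker lfunE. Qed.

End OreRing.

Section Drinfeld.
Variables (Fq : finFieldType) (A : comAlgType Fq) (K : fieldExtType Fq).
Variable gamma : {lrmorphism A -> K}.

Record drinfeld_module := DrinfeldModule {
  drinfeld_map :> {lrmorphism A -> ore K};
  drinfeld_nonconst : ~ (forall a, exists c, drinfeld_map a = oreC c);
  drinfeld_coef0 : forall a, ore_coef (drinfeld_map a) 0 = gamma a }.

Definition drinfeld_morphism (phi psi : drinfeld_module) (u : ore K) : Prop :=
  forall a, u * phi a = psi a * u.

Section KernelModule.
Variables (phi psi : drinfeld_module) (u : ore K).
Hypothesis phi_psi_u : drinfeld_morphism phi psi u.

Fact kerK_stable a x : x \in kerK u -> ore_eval (phi a) x \in kerK u.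
Proof.
rewrite !mem_kerK => /eqP ux0.
rewrite /ore_eval -ore_evalM phi_psi_u ore_evalM -/(ore_eval u x) ux0.
exact/eqP/(linear0 (ore_eval (psi a))).
Qed.

(* phi(ker_K(u)): the proof that u is a morphism is a phantom argument, needed
   for the action of A below. *)
Definition ker_module of drinfeld_morphism phi psi u : Type := subvs_of (kerK u).

Local Notation W := (ker_module phi_psi_u).
HB.instance Definition _ := GRing.Zmodule.on W.

Definition ker_scale (a : A) (z : W) : W := Subvs (kerK_stable a (subvsP z)).

Lemma val_ker_scale a z : vsval (ker_scale a z) = ore_eval (phi a) (vsval z).
Proof. by []. Qed.

Fact ker_scaleA a b z : ker_scale a (ker_scale b z) = ker_scale (a * b) z.
Proof. by apply: val_inj; rewrite /= /ore_eval rmorphM ore_evalM. Qed.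
Fact ker_scale1 : left_id 1 ker_scale.
Proof.
by move=> z; apply: val_inj; rewrite /= /ore_eval rmorph1 ore_evalC mul1r.
Qed.
Fact ker_scaleDr : right_distributive ker_scale +%R.
Proof. by move=> a z t; apply: val_inj; rewrite /= linearD. Qed.
Fact ker_scaleDl z : {morph ker_scale^~ z : a b / a + b}.
Proof. by move=> a b; apply: val_inj; rewrite /= /ore_eval rmorphD ore_evalD. Qed.

HB.instance Definition _ := GRing.Zmodule_isLmodule.Build A W
  ker_scaleA ker_scale1 ker_scaleDr ker_scaleDl.

End KernelModule.

(* The matrix of phi_a on the span of b, in row-vector convention. *)
Definition action_mx (phi : drinfeld_module) d (b : d.-tuple K)
    (a : A) : 'M[Fq]_d :=
  \matrix_(i, l) coord b l (ore_eval (phi a) b`_i).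

End Drinfeld.

Definition char_mx (Fq : finFieldType) (A : comAlgType Fq) (m d : nat)
    (g : 'I_m -> A) (M : 'I_m -> 'M[Fq]_d) : 'M[A]_(\sum_(k < m) d, d) :=
  \mxcol_(k < m) ((g k)%:M - map_mx (in_alg A) (M k)).

(* Main.v *)
Require Import Defs.
From HB Require Import structures.
From mathcomp Require Import all_boot all_order all_algebra all_field.
From mathcomp Require Import boolp ring perm zify.

Set Implicit Arguments.
Unset Strict Implicit.
Unset Printing Implicit Defensive.

Import GRing.Theory.
Local Open Scope ring_scope.

(** Let W be the kernel module, with basis [b], and let M be the characteristic
    matrix. The vectors of [b] generate W over A and satisfy the relations given by
    the rows of M. These relations are all: the elements g for which the rows of
    g Id - rho(g) are combinations of the rows of M, where rho(g) is the matrix of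
    g, form a subalgebra that contains the generators of A ([char_mx_generates]).
    So modulo the rows of M every vector over A is congruent to one with entries in
    Fq, and on those the map to W is injective ([presentation_map_ker]).

    For the invariant factors, choose a nonzero nonunit [a] of A that kills W; it
    exists because A contains an element transcendental over Fq, while W and the
    field K are finite. Then a Id is a left multiple
    of M, so the ideal of k x k minors of M contains the k-th power of [a]. The
    elements of A invertible modulo [a] are denominators of a semilocal Dedekind
    domain, hence of a principal ideal domain, in which M has a Smith form with
    diagonal s_0 | s_1 | ... ([smith]). An ideal of A that contains a power of [a]
    is determined by its extension to this localization ([ideal_unit_mod]). This
    identifies the k x k minors with s_0 ... s_(k-1) ([minors_sat]), the i-th
    quotient of Fitting ideals with s_i ([diag_frac_quot]), and W with the sum of
    the cyclic modules A/(s_i) ([diag_invariant_factors]).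

    That A is Dedekind is used in the form that of two elements one divides the
    other in the localization at any maximal ideal ([local_divisibility]). It rests
    on two facts. First, A/(a) is finite for all nonzero [a]: any two elements of
    the function field are algebraically dependent over Fq, by a count of monomials
    ([algebraic_dependence]), so that every generator of A is algebraic modulo [a].
    Second, A is an intersection of valuation rings, so that no element of the
    function field outside A maps a nonzero ideal of A into itself
    ([function_ring_closed]). In the finite ring A/(a) some element has annihilator
    exactly m/(a), and this produces a uniformizer at m ([uniformizer]). *)

(** * Ideals with finite quotient *)

Section Ideals.
Variable A : comNzRingType.
Implicit Types (I J m : ideal A) (a x y : A).

Lemma ideal_0 I : I 0. Proof. exact: submod0. Qed.

Lemma ideal_D I x y : I x -> I y -> I (x + y).
Proof. exact: submodD. Qed.

Lemma ideal_Ml I x y : I y -> I (x * y).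
Proof. exact: (@submodZ _ _ I x y). Qed.

Lemma ideal_Mr I x y : I x -> I (x * y).
Proof. by rewrite mulrC; apply: ideal_Ml. Qed.

Lemma ideal_N I x : I x -> I (- x).
Proof. by rewrite -mulN1r; apply: ideal_Ml. Qed.

Lemma ideal_B I x y : I x -> I y -> I (x - y).
Proof. by move=> Ix Iy; apply/ideal_D/ideal_N. Qed.

Lemma ideal_sum I (T : Type) (s : seq T) (P : pred T) (G : T -> A) :
  (forall t, P t -> I (G t)) -> I (\sum_(t <- s | P t) G t).
Proof.
by move=> IG; apply: (big_ind (fun x => I x)) => //;
  [exact: ideal_0 | exact: ideal_D].
Qed.

Fact adjoin_D J x y z : (exists j c, J j /\ y = j + c * x) ->
  (exists j c, J j /\ z = j + c * x) -> exists j c, J j /\ y + z = j + c * x.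
Proof.
move=> [j [c [Jj ->]]] [j' [c' [Jj' ->]]]; exists (j + j'), (c + c').
by split; [apply: ideal_D | ring].
Qed.

Fact adjoin_M J x (z y : A) : (exists j c, J j /\ y = j + c * x) ->
  exists j c, J j /\ z * y = j + c * x.
Proof.
move=> [j [c [Jj ->]]]; exists (z * j), (z * c).
by split; [apply: ideal_Ml | ring].
Qed.

Fact adjoin_0 J x : exists j c, J j /\ 0 = j + c * x.
Proof. by exists 0, 0; split; [exact: ideal_0 | ring]. Qed.

Definition adjoin J x : ideal A :=
  @Submod A A^o _ (adjoin_0 J x) (@adjoin_D J x) (@adjoin_M J x).

Lemma adjoin_sub J x y : J y -> adjoin J x y.
Proof. by exists y, 0; split=> //; ring. Qed.

Lemma adjoin_mem J x : adjoin J x x.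
Proof. by exists 0, 1; split; [exact: ideal_0 | ring]. Qed.

Lemma adjoin_min J m x : (forall y, J y -> m y) -> m x ->
  forall y, adjoin J x y -> m y.
Proof.
by move=> Jm mx _ [y [c [/Jm my ->]]]; apply/ideal_D/ideal_Ml.
Qed.

Definition maximal m := ~ m 1 /\ forall x, ~ m x -> exists y, m (1 - x * y).

Lemma maximal_prime m x y : maximal m -> m (x * y) -> m x \/ m y.
Proof.
move=> [m1 max_m] mxy; have [mx|/max_m[z mz]] := EM (m x); first by left.
right; have -> : y = (1 - x * z) * y + z * (x * y) by ring.
by apply: ideal_D; [apply: ideal_Mr | apply: ideal_Ml].
Qed.

Lemma maximal_notM m x y : maximal m -> ~ m x -> ~ m y -> ~ m (x * y).
Proof. by move=> max_m mx my /(maximal_prime max_m)[]. Qed.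

Lemma maximal_X m x n : maximal m -> m (x ^+ n) -> m x.
Proof.
move=> max_m; elim: n => [|n IHn]; first by case: max_m.
by rewrite exprS => /(maximal_prime max_m)[|/IHn].
Qed.

Lemma maximal_eq m m' x : maximal m -> maximal m' ->
  (forall y, m y -> m' y) -> m' x -> m x.
Proof.
move=> [_ max_m] [m'1 _] sub m'x; apply: contrapT => /max_m[y /sub m'y].
apply: m'1; have -> : 1 = (1 - x * y) + x * y by ring.
by apply/ideal_D/ideal_Mr.
Qed.

(** A/(a) is finite: [val] enumerates, perhaps with repetitions, representatives
    of the classes modulo [a]. *)
Definition finite_mod a := exists (X : finType) (val : X -> A),
  forall y, exists c b, y = val c + a * b.

(** Two powers of [x] agree modulo [a], so the powers are eventually periodic, and an
    exponent that is a multiple of the period beyond the preperiod works. *)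
Lemma finite_mod_idempotent a x : finite_mod a ->
  exists2 n, (0 < n)%N & exists b, x ^+ n * (1 - x ^+ n) = a * b.
Proof.
move=> [X [val valP]].
have [f fP] := choice (fun i => valP (x ^+ i)).
have /injectivePn[i0 [j0 ne_ij eq_f]] : ~~ injectiveb (fun i : 'I_#|X|.+1 => f i).
  by apply/negP=> /injectiveP/leq_card; rewrite card_ord ltnn.
have [i [j [lt_ij eq_ij]]] : exists i j, (i < j)%N /\ f i = f j.
  have := ne_ij; rewrite neq_ltn => /orP[|] lt; last by exists j0, i0.
  by exists i0, j0.
have [[bi ei] [bj ej]] := (fP i, fP j).
pose k := (j - i)%N; have k_gt0 : (0 < k)%N by rewrite subn_gt0.
have step r s : (i <= r)%N ->
    exists b, x ^+ (r + s * k) = x ^+ r + a * b.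
  move=> le_ir; elim: s => [|s [b IHs]]; first by exists 0; rewrite addn0; ring.
  exists (b + (bj - bi) * x ^+ (r - i + s * k)).
  have -> : (r + s.+1 * k = j + (r - i + s * k))%N.
    by rewrite mulSn -{1}(subnK le_ir) -(subnKC (ltnW lt_ij)) -/k; ring.
  rewrite exprD ej -eq_ij.
  transitivity (x ^+ i * x ^+ (r - i + s * k)
     + a * ((bj - bi) * x ^+ (r - i + s * k))); first by rewrite ei; ring.
  by rewrite -exprD addnA subnKC // IHs; ring.
exists (k * i.+1)%N; first by rewrite muln_gt0 k_gt0.
have le_i : (i <= k * i.+1)%N.
  by rewrite (leq_trans (leqnSn i)) // leq_pmull.
have [b eb] := step _ i.+1 le_i.
exists (- b); rewrite mulrBr mulr1 -exprD {3}[(k * _)%N]mulnC eb; ring.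
Qed.

Section FiniteQuotient.
Variables (a : A) (X : finType) (val : X -> A).
Hypothesis valP : forall y, exists c b, y = val c + a * b.

(** Strictly increasing in ideals [I] above [a], and bounded; this replaces the
    Noetherian condition in inductions on ideals. *)
Definition weight I := #|[set c : X | `[< I (val c) >]]|.

Lemma weight_max I : (weight I <= #|X|)%N.
Proof. exact: max_card. Qed.

Lemma weight_lt I J y : I a -> (forall x, I x -> J x) -> J y -> ~ I y ->
  (weight I < weight J)%N.
Proof.
move=> Ia IJ Jy nIy; apply: proper_card; apply/properP; split.
  by apply/subsetP => c; rewrite !inE => /asboolP/IJ ?; apply/asboolP.
have [c [b def_y]] := valP y.
have def_c : val c = y - a * b by rewrite def_y; ring.
exists c; rewrite !inE; first by apply/asboolP; rewrite def_c;
  apply/ideal_B/ideal_Mr/IJ.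
apply/negP=> /asboolP Ic; apply: nIy; rewrite def_y.
by apply/ideal_D/ideal_Mr.
Qed.

End FiniteQuotient.

Lemma maximal_exists a I : finite_mod a -> I a -> ~ I 1 ->
  exists2 m, maximal m & forall x, I x -> m x.
Proof.
move=> [X [val valP]].
have [n] := ubnP (#|X| - weight val I); elim: n => // n IHn in I *.
move=> le_n Ia I1; have [max_I|not_max] := EM (maximal I); first by exists I.
have [x [Ix Ix1]] : exists x, ~ I x /\ ~ adjoin I x 1.
  apply: contrapT => no_x; apply: not_max; split=> // x Ix.
  have [[j [c [Ij e]]]|?] := EM (adjoin I x 1).
    by exists c; rewrite e; have -> : j + c * x - x * c = j by ring.
  by case: no_x; exists x.
have lt := weight_lt valP Ia (@adjoin_sub I x) (adjoin_mem I x) Ix.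
have [|m max_m sub] := IHn _ _ (adjoin_sub x Ia) Ix1.
  rewrite -ltnS; apply: leq_trans le_n; rewrite ltnS ltn_sub2l //.
  exact: leq_trans lt (weight_max _ _).
by exists m => // y Iy; apply/sub/adjoin_sub.
Qed.

(** The denominators of a semilocal ring of fractions of A, whose maximal ideals
    come from the maximal ideals of A above [a]. *)
Definition unit_mod a e := exists c r, e * c + a * r = 1.

Lemma unit_mod1 a : unit_mod a 1.
Proof. by exists 1, 0; ring. Qed.

Lemma unit_modM a x y : unit_mod a x -> unit_mod a y -> unit_mod a (x * y).
Proof.
move=> [c [r e]] [c' [r' e']]; exists (c * c'), (r' + r * y * c').
transitivity ((x * c + a * r) * (y * c') + a * r'); first by ring.
by rewrite e mul1r e'.
Qed.

Lemma unit_modX a x n : unit_mod a x -> unit_mod a (x ^+ n).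
Proof.
move=> ax; elim: n => [|n IHn]; first exact: unit_mod1.
by rewrite exprS; apply: unit_modM.
Qed.

(** Otherwise [I] and [a] generate a proper ideal, which lies in a maximal one. *)
Lemma meets_unit_mod a I : finite_mod a ->
  (forall m, maximal m -> m a -> exists2 x, I x & ~ m x) ->
  exists2 e, I e & unit_mod a e.
Proof.
move=> fin_a notin_I; have [[j [c [Ij e1]]]|no1] := EM (adjoin I a 1).
  by exists j => //; exists 1, c; rewrite [RHS]e1; ring.
have [m max_m sub] := maximal_exists fin_a (adjoin_mem I a) no1.
have [x Ix []] := notin_I m max_m (sub _ (adjoin_mem I a)).
exact/sub/adjoin_sub.
Qed.

Fact principal0 x : exists c, 0 = x * c.
Proof. by exists 0; ring. Qed.

Fact principalD x y z :
  (exists c, y = x * c) -> (exists c, z = x * c) -> exists c, y + z = x * c.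
Proof. by move=> [c ->] [c' ->]; exists (c + c'); ring. Qed.

Fact principalM x (z y : A) : (exists c, y = x * c) -> exists c, z * y = x * c.
Proof. by move=> [c ->]; exists (z * c); ring. Qed.

Definition principal x : ideal A :=
  @Submod A A^o _ (principal0 x) (@principalD x) (@principalM x).

Lemma unit_mod_maximal a x : finite_mod a ->
  (forall m, maximal m -> m a -> ~ m x) -> unit_mod a x.
Proof.
move=> fin_a xP.
have [m max_m ma|_ [d ->] [c [r e]]] := @meets_unit_mod a (principal x) fin_a.
  by exists x; [exists 1; ring | exact: xP].
by exists (d * c), r; rewrite mulrA.
Qed.

(** The idempotents of the finite ring A/(a) separate its maximal ideals, so that
    one option chosen at each maximal ideal yields weights, one for each option,
    that select the chosen option everywhere. *)
Lemma partition_of_unity a (T : finType) (good : ideal A -> T -> Prop) :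
  finite_mod a -> (forall m, maximal m -> m a -> exists t, good m t) ->
  exists om : T -> A, forall m, maximal m -> m a -> exists m' t,
    [/\ good m' t, forall x, m' x <-> m x
      & forall t', m (om t' - (t' == t)%:R)].
Proof.
move=> fin_a goodP; have [X [val valP]] := fin_a.
suff glue (J : ideal A) : J a -> exists om : T -> A,
    forall m, maximal m -> (forall x, J x -> m x) -> exists m' t,
    [/\ good m' t, forall x, m' x <-> m x
      & forall t', m (om t' - (t' == t)%:R)].
  have [|om omP] := glue (principal a); first by exists 1; ring.
  by exists om => m max_m ma; apply: omP => // _ [c ->]; apply: ideal_Mr.
have [n] := ubnP (#|X| - weight val J); elim: n => // n IHn in J * => le_n Ja.
have [[m0 [max0 J0]]|no_m] :=
    EM (exists m, maximal m /\ forall x, J x -> m x); last first.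
  by exists (fun=> 0) => m max_m Jm; case: no_m; exists m.
(* Either [m0] is the only maximal ideal above [J], or an element [x] of another one
   outside [m0] has a power [e] that is idempotent modulo [J] and nontrivial; then
   the weights found above [J] + ([e]) and above [J] + (1 - [e]) are combined. *)
have [[m [x [max_m Jm mx m0x]]]|loc] :=
    EM (exists m x, [/\ maximal m, forall y, J y -> m y, m x & ~ m0 x]);
    last first.
  have [t0 good0] := goodP m0 max0 (J0 _ Ja).
  exists (fun t => (t == t0)%:R) => m max_m Jm; exists m0, t0.
  have sub x : m x -> m0 x.
    by move=> mx; apply: contrapT => m0x; case: loc; exists m, x.
  split=> // [x|t]; last by rewrite subrr; apply: ideal_0.
  by split; [apply: (maximal_eq max_m max0 sub) | apply: sub].
have [k k_gt0 [b eb]] := finite_mod_idempotent x fin_a.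
pose e := x ^+ k; rewrite -/e in eb.
have Je1 : J (e * (1 - e)) by rewrite eb; apply: ideal_Mr.
have me : m e by rewrite /e -(prednK k_gt0) exprS; apply: ideal_Mr.
have Je : ~ J e by move=> /J0/(maximal_X max0).
have J1e : ~ J (1 - e).
  move=> /Jm m1e; case: max_m => m1 _; apply: m1.
  by rewrite -(subrK e 1); apply: ideal_D.
have weight_adjoin y : ~ J y -> (#|X| - weight val (adjoin J y) < n)%N.
  move=> Jy; have lt := weight_lt valP Ja (@adjoin_sub J y) (adjoin_mem J y) Jy.
  rewrite -ltnS; apply: leq_trans le_n; rewrite ltnS ltn_sub2l //.
  exact: leq_trans lt (weight_max _ _).
have [om1 om1P] := IHn _ (weight_adjoin _ Je) (adjoin_sub _ Ja).
have [om2 om2P] := IHn _ (weight_adjoin _ J1e) (adjoin_sub _ Ja).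
exists (fun t => (1 - e) * om1 t + e * om2 t) => m' max' Jm'.
have [m'e|m'e] := maximal_prime max' (Jm' _ Je1).
  have [|m1 [t [good1 eq1 om1t]]] := om1P m' max'; first exact: adjoin_min.
  exists m1, t; split=> // t'.
  set d := (t' == t)%:R.
  have -> : (1 - e) * om1 t' + e * om2 t' - d
    = (om1 t' - d) + e * (om2 t' - om1 t') by ring.
  by apply/ideal_D/ideal_Mr.
have [|m1 [t [good1 eq1 om2t]]] := om2P m' max'; first exact: adjoin_min.
exists m1, t; split=> // t'.
set d := (t' == t)%:R.
have -> : (1 - e) * om1 t' + e * om2 t' - d
  = (om2 t' - d) + (1 - e) * (om1 t' - om2 t') by ring.
by apply/ideal_D/ideal_Mr.
Qed.

End Ideals.

(** * Localization at a maximal ideal *)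

Section LocalDivisibility.
Variable A : comNzRingType.
Implicit Types (I J m : ideal A) (a b x y t w : A).

Definition no_zero_divisors := forall x y, x * y = 0 -> x = 0 \/ y = 0.

(** Integral closedness, in the form in which it is used: b/a lies in A as soon as
    it maps some nonzero ideal into itself. *)
Definition ideally_closed := forall m a b, m a -> a <> 0 ->
  (forall x, m x -> exists2 y, m y & b * x = a * y) -> exists c, b = a * c.

Hypotheses (domA : no_zero_divisors) (closedA : ideally_closed)
  (finA : forall a, a <> 0 -> finite_mod a).

Lemma domain_cancel x y z : x <> 0 -> x * y = x * z -> y = z.
Proof.
move=> nz_x /eqP; rewrite -subr_eq0 -mulrBr => /eqP/domA[//|/eqP].
by rewrite subr_eq0 => /eqP.
Qed.

Lemma domain_neq0M x y : x <> 0 -> y <> 0 -> x * y <> 0.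
Proof. by move=> nz_x nz_y /domA[]. Qed.

Lemma domain_neq0X x n : x <> 0 -> x ^+ n <> 0.
Proof.
move=> nz_x; elim: n => [|n IHn]; first exact/eqP/oner_neq0.
by rewrite exprS; apply: domain_neq0M.
Qed.

Section Colon.
Variables a b : A.

Fact colon0 : exists c, 0 * b = a * c.
Proof. by exists 0; ring. Qed.

Fact colonD x y : (exists c, x * b = a * c) -> (exists c, y * b = a * c) ->
  exists c, (x + y) * b = a * c.
Proof. by move=> [c e] [c' e']; exists (c + c'); rewrite mulrDl e e'; ring. Qed.

Fact colonM z x : (exists c, x * b = a * c) -> exists c, (z * x) * b = a * c.
Proof. by move=> [c e]; exists (z * c); rewrite -mulrA e; ring. Qed.

(** The annihilator of the class of [b] in A/(a). *)
Definition colon : ideal A := @Submod A A^o _ colon0 colonD colonM.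

End Colon.

Lemma colon_sub a b z x : colon a b x -> colon a (z * b) x.
Proof. by move=> [c e]; exists (z * c); rewrite mulrCA e; ring. Qed.

(** A maximal ideal is associated to A/(a), because this ring is finite: a colon
    ideal that is maximal among those inside [m] must be [m] itself. *)
Lemma maximal_colon a m : finite_mod a -> maximal m -> m a ->
  exists b, forall x, colon a b x <-> m x.
Proof.
move=> fin_a max_m ma; have [X [val valP]] := fin_a.
have colon_a b : colon a b a by exists b.
have [b [bm b_max]] : exists b, (forall x, colon a b x -> m x) /\
    forall z, (forall x, colon a (z * b) x -> m x) ->
    forall x, colon a (z * b) x -> colon a b x.
  suff: forall b, (forall x, colon a b x -> m x) ->
      exists b, (forall x, colon a b x -> m x) /\
        forall z, (forall x, colon a (z * b) x -> m x) ->
        forall x, colon a (z * b) x -> colon a b x.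
    by move=> /(_ 1); apply=> x [c]; rewrite mulr1 => ->; apply: ideal_Mr.
  move=> b; have [n] := ubnP (#|X| - weight val (colon a b)).
  elim: n => // n IHn in b * => le_n bm.
  have [[z [zm [x [zx bx]]]]|no_z] := EM (exists z,
    (forall x, colon a (z * b) x -> m x) /\
    exists x, colon a (z * b) x /\ ~ colon a b x); last first.
    exists b; split=> // z zm x zx; apply: contrapT => bx; apply: no_z.
    by exists z; split=> //; exists x.
  apply: (IHn (z * b)) => //; rewrite -ltnS; apply: leq_trans le_n.
  have lt := weight_lt valP (colon_a b) (@colon_sub a b z) zx bx.
  rewrite ltnS ltn_sub2l //; exact: leq_trans lt (weight_max _ _).
exists b => r; split=> [|mr]; first exact: bm.
have [rm|rm] := EM (forall x, colon a (r * b) x -> m x).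
  have rX n : forall x, colon a (r ^+ n * b) x -> colon a b x.
    elim: n => [|n IHn] x; first by rewrite mul1r.
    move=> [c e]; apply: IHn; have [|d f] := b_max r rm (x * r ^+ n).
      by exists c; rewrite -e exprS; ring.
    by exists d; rewrite -f mulrA.
  have [n n_gt0 [c e]] := finite_mod_idempotent r fin_a.
  case: (max_m) => m1 _; case: m1.
  rewrite -(subrK (r ^+ n) 1); apply: ideal_D.
    by apply/bm/(rX n); exists (c * b); rewrite mulrA [RHS]mulrA -e; ring.
  by rewrite -(prednK n_gt0) exprS; apply: ideal_Mr.
have [w [[c e] mw]] : exists w, colon a (r * b) w /\ ~ m w.
  apply: contrapT => no_w; apply: rm => w cw; apply: contrapT => mw.
  by apply: no_w; exists w.
apply: (b_max w) => [x [d f]|]; last by exists c; rewrite -e; ring.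
have /(maximal_prime max_m)[//|] : m (x * w) by apply: bm; exists d; rewrite -f; ring.
by move/mw.
Qed.

(** The localization at a maximal ideal [m] has a uniformizer [t]. If [m] is the
    colon ideal of [b] modulo [a], then b/a maps [m] into A, and not into [m] by
    integral closedness; [t] is an element of [m] that b/a maps to a local unit. *)
Lemma uniformizer a m : a <> 0 -> maximal m -> m a ->
  exists t w, [/\ m t, ~ m w & forall x, m x -> exists y, w * x = t * y].
Proof.
move=> nz_a max_m ma; have [b bP] := maximal_colon (finA nz_a) max_m ma.
have [[t [w [mt mw e]]]|no_t] := EM (exists t w, [/\ m t, ~ m w & t * b = a * w]).
  exists t, w; split=> // x /bP[y f]; exists y.
  by apply: (domain_cancel nz_a); rewrite mulrA -e -mulrA [b * x]mulrC f; ring.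
have [x mx|c e] := closedA (b := b) ma nz_a.
  have /bP[y e] := mx; exists y; last by rewrite mulrC.
  by apply: contrapT => my; apply: no_t; exists x, y.
case: max_m => m1 _; case: m1; apply/bP; exists c; rewrite e; ring.
Qed.

(** If the local division of [x] by [t] never stopped, then [x] would be locally
    divisible by all powers of [t], whereas some t^n (1 - t^n) is a multiple of [x]
    because A/(x) is finite. *)
Lemma uniformizer_order a m t w : a <> 0 -> maximal m -> m a ->
  m t -> ~ m w -> (forall x, m x -> exists y, w * x = t * y) ->
  forall x, x <> 0 -> exists n v x', [/\ ~ m v, ~ m x' & v * x = t ^+ n * x'].
Proof.
move=> nz_a max_m ma mt mw tP x nz_x; apply: contrapT => no_n.
have all_m n : exists2 x', m x' & w ^+ n * x = t ^+ n * x'.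
  have mem n' x' : w ^+ n' * x = t ^+ n' * x' -> m x'.
    move=> e; apply: contrapT => mx'; apply: no_n; exists n', (w ^+ n'), x'.
    by split=> // /(maximal_X max_m).
  elim: n => [|n [x' mx' e]]; first by exists x => //; apply: (mem 0%N).
  have [x'' e'] := tP x' mx'.
  have e'' : w ^+ n.+1 * x = t ^+ n.+1 * x''.
    by rewrite !exprSr -!mulrA -e' mulrCA e; ring.
  by exists x'' => //; apply: mem e''.
have nz_t : t <> 0.
  move=> t0; have [y] := tP a ma; rewrite t0 mul0r => /domA[w0|//].
  by apply: mw; rewrite w0; apply: ideal_0.
have [n n_gt0 [c e]] := finite_mod_idempotent t (finA nz_x).
have [x' mx' e'] := all_m n.+1.
have e2 : w ^+ n.+1 * (1 - t ^+ n) = t * x' * c.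
  apply: (domain_cancel (domain_neq0X (n := n) nz_t)).
  by rewrite mulrCA e [RHS]mulrA [_ * (t * x')]mulrA -exprSr -e' mulrA.
have : m (w ^+ n.+1 * (1 - t ^+ n)) by rewrite e2; apply/ideal_Mr/ideal_Mr.
case/(maximal_prime max_m) => [/(maximal_X max_m)//|m1].
case: (max_m) => m1' _; apply: m1'; rewrite -(subrK (t ^+ n) 1); apply: ideal_D => //.
by rewrite -(prednK n_gt0) exprS; apply: ideal_Mr.
Qed.

(** The localization of A at [m] is a valuation ring: the element with the smaller
    order at the uniformizer divides the other. *)
Lemma local_divisibility a m x y : a <> 0 -> maximal m -> m a ->
  exists2 w, ~ m w & (exists c, w * y = x * c) \/ (exists c, w * x = y * c).
Proof.
move=> nz_a max_m ma; have m1 : ~ m 1 by case: max_m.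
have [->|nz_x] := EM (x = 0); first by exists 1 => //; right; exists 0; ring.
have [->|nz_y] := EM (y = 0); first by exists 1 => //; left; exists 0; ring.
have [t [w [mt mw tP]]] := uniformizer nz_a max_m ma.
have ord := uniformizer_order nz_a max_m ma mt mw tP.
have [n [v [x' [mv mx' e]]]] := ord x nz_x.
have [n' [v' [y' [mv' my' e']]]] := ord y nz_y.
have [le|/ltnW le] := leqP n n'.
  exists (x' * v'); first exact: maximal_notM.
  left; exists (t ^+ (n' - n) * y' * v).
  transitivity (x' * (v' * y)); first by ring.
  rewrite e' -{1}(subnK le) exprD.
  transitivity (t ^+ (n' - n) * y' * (t ^+ n * x')); first by ring.
  by rewrite -e; ring.
exists (y' * v); first exact: maximal_notM.
right; exists (t ^+ (n - n') * x' * v').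
transitivity (y' * (v * x)); first by ring.
rewrite e -{1}(subnK le) exprD.
transitivity (t ^+ (n - n') * x' * (t ^+ n' * y')); first by ring.
by rewrite -e'; ring.
Qed.

End LocalDivisibility.

(** * Smith form up to denominators *)

Section CongruentMatrices.
Variables (A : comNzRingType) (m : ideal A).

Definition congr_mx r d (X Y : 'M[A]_(r, d)) := forall i j, m (X i j - Y i j).

Lemma congr_mul (x x' y y' : A) : m (x - x') -> m (y - y') -> m (x * y - x' * y').
Proof.
move=> mx my; have -> : x * y - x' * y' = (x - x') * y + x' * (y - y') by ring.
by apply: ideal_D; [apply: ideal_Mr | apply: ideal_Ml].
Qed.

Lemma congr_mulmx r n d (X X' : 'M_(r, n)) (Y Y' : 'M_(n, d)) :
  congr_mx X X' -> congr_mx Y Y' -> congr_mx (X *m Y) (X' *m Y').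
Proof.
move=> mX mY i j; rewrite !mxE -sumrB; apply: ideal_sum => k _.
exact: congr_mul.
Qed.

Lemma congr_mx_refl r d (X : 'M_(r, d)) : congr_mx X X.
Proof. by move=> i j; rewrite subrr; apply: ideal_0. Qed.

Lemma congr_det n (X Y : 'M_n) : congr_mx X Y -> m (\det X - \det Y).
Proof.
move=> mXY; rewrite /determinant -sumrB; apply: ideal_sum => s _.
rewrite -mulrBr; apply: ideal_Ml.
apply: (big_ind2 (fun x y => m (x - y))) => [||i _]; last exact: mXY.
  by rewrite subrr; apply: ideal_0.
by move=> x x' y y'; apply: congr_mul.
Qed.

End CongruentMatrices.

Section Smith.
Variables (A : comNzRingType) (a : A).
Implicit Types (x y w : A).
Hypotheses (domA : no_zero_divisors A) (fin_a : finite_mod a).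
Hypothesis nonunit_a : forall r, a * r <> 1.
Hypothesis local_div : forall (m : ideal A) x y, maximal m -> m a ->
  exists2 w : A, ~ m w & (exists c, w * y = x * c) \/ (exists c, w * x = y * c).

Local Notation S := (unit_mod a).

Lemma unit_mod_neq0 e : S e -> e <> 0.
Proof. by move=> [c [r e1]] e0; apply: (nonunit_a (r := r)); rewrite -e1 e0; ring. Qed.

(** The normalization [c t = w] makes the quotient of the minimal entry by itself a
    local unit even if this entry is zero. *)
Lemma local_minimum (m : ideal A) (T : finType) (x : T -> A) (t0 : T) :
  maximal m -> m a -> exists t w (c : T -> A),
    [/\ ~ m w, c t = w & forall t', w * x t' = x t * c t'].
Proof.
move=> max_m ma.
have [t [w [mw wP]]] : exists t w, ~ m w /\
    forall t', t' \in enum T -> exists c, w * x t' = x t * c.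
  elim: (enum T) => [|t1 s [t [w [mw wP]]]].
    by exists t0, 1; split=> //; case: max_m.
  have [v mv [[c e]|[c e]]] := local_div (x t) (x t1) max_m ma.
    exists t, (w * v); split=> [|t']; first exact: maximal_notM.
    rewrite inE => /predU1P[->|/wP[c' e']].
      by exists (w * c); rewrite -mulrA e; ring.
    by exists (v * c'); rewrite mulrAC e'; ring.
  exists t1, (w * v); split=> [|t']; first exact: maximal_notM.
  rewrite inE => /predU1P[->|/wP[c' e']]; first by exists (w * v); ring.
  by exists (c * c'); rewrite mulrAC e' [RHS]mulrA -e; ring.
have [c cP] := choice (fun t' => wP t' (mem_enum T t')).
exists t, w, (fun t' => if t' == t then w else c t'); split=> //.
  by rewrite eqxx.
by move=> t'; case: eqP => [->|_]; [ring | apply: cP].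
Qed.

(** At each maximal ideal above [a] some entry divides all the others locally, and a
    row swap and a column swap bring it to the corner. The glued swaps do this at
    all of these maximal ideals at once. *)
Lemma pivot r d (M : 'M[A]_(r.+1, d.+1)) : exists U V e C,
  [/\ S (\det U), S (\det V), S e & e *: M = (U *m M *m V) 0 0 *: C].
Proof.
pose good (m : ideal A) (t : 'I_r.+1 * 'I_d.+1) := exists (w : A) (C : 'M_(r.+1, d.+1)),
  [/\ ~ m w, C t.1 t.2 = w & w *: M = M t.1 t.2 *: C].
have [|om omP] := @partition_of_unity A a _ good fin_a.
  move=> m max_m ma.
  have [t [w [c [mw cw wP]]]] :=
    local_minimum (fun t : 'I_r.+1 * 'I_d.+1 => M t.1 t.2) (0, 0) max_m ma.
  exists t, w, (\matrix_(i, j) c (i, j)); split=> //.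
    by rewrite mxE -surjective_pairing.
  by apply/matrixP=> i j; rewrite !mxE (wP (i, j)).
pose U := \sum_t om t *: tperm_mx 0 t.1 : 'M[A]_r.+1.
pose V := \sum_t om t *: tperm_mx 0 t.2 : 'M[A]_d.+1.
have glue (m : ideal A) t n (f : 'I_r.+1 * 'I_d.+1 -> 'M[A]_n) :
    (forall t', m (om t' - (t' == t)%:R)) ->
    congr_mx m (\sum_t' om t' *: f t') (f t).
  move=> omt i j; rewrite summxE.
  have -> : f t i j = \sum_t' (t' == t)%:R * f t' i j.
    rewrite (bigD1 t) //= eqxx mul1r big1 ?addr0 // => t' /negPf->.
    by rewrite mul0r.
  rewrite -sumrB; apply: ideal_sum => t' _; rewrite !mxE -mulrBl.
  exact: ideal_Mr.
have det_swap (m : ideal A) n (X : 'M[A]_n) s :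
    maximal m -> congr_mx m X (perm_mx s) -> ~ m (\det X).
  move=> [m1 _] /congr_det; rewrite det_perm => mX mdet; apply: m1.
  have -> : 1 = (-1) ^+ s * (\det X - (\det X - (-1) ^+ s)) :> A.
    by rewrite subKr -signr_addb addbb.
  by apply/ideal_Ml/ideal_B.
have SU : S (\det U).
  apply: unit_mod_maximal => // m max_m ma.
  have [_ [t [_ _ omt]]] := omP m max_m ma.
  exact: det_swap (glue _ _ _ (fun t => tperm_mx 0 t.1) omt).
have SV : S (\det V).
  apply: unit_mod_maximal => // m max_m ma.
  have [_ [t [_ _ omt]]] := omP m max_m ma.
  exact: det_swap (glue _ _ _ (fun t => tperm_mx 0 t.2) omt).
pose g := (U *m M *m V) 0 0.
have I0 : exists C, 0 *: M = g *: C by exists 0; rewrite scale0r scaler0.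
have ID x y : (exists C, x *: M = g *: C) -> (exists C, y *: M = g *: C) ->
    exists C, (x + y) *: M = g *: C.
  by move=> [C e] [C' e']; exists (C + C'); rewrite scalerDl scalerDr e e'.
have IZ b x : (exists C, x *: M = g *: C) -> exists C, (b * x) *: M = g *: C.
  by move=> [C e]; exists (b *: C); rewrite -scalerA e !scalerA mulrC.
pose I : ideal A := @Submod A A^o _ I0 ID IZ.
have [m max_m ma|e [C eC] Se] := @meets_unit_mod A a I fin_a; last first.
  by exists U, V, e, C.
(* At [m] the corner entry is the pivot times [k], and [k] is congruent to [w]. *)
have [m' [t [[w [C [mw Ct wM]]] eq_m omt]]] := omP m max_m ma.
pose k := (U *m C *m V) 0 0.
have gk : w * g = M t.1 t.2 * k.
  have e : w *: (U *m M *m V) = M t.1 t.2 *: (U *m C *m V).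
    by rewrite scalemxAl scalemxAr wM -scalemxAr -scalemxAl.
  by have := congr1 (fun X : 'M_(_, _) => X 0 0) e; rewrite [LHS]mxE [RHS]mxE.
have mk : ~ m k.
  move=> mk; apply/mw/eq_m; rewrite -Ct -(subKr k (C t.1 t.2)).
  apply: ideal_B => //.
  have -> : C t.1 t.2 = (tperm_mx 0 t.1 *m C *m tperm_mx 0 t.2) 0 0.
    by rewrite -xcolE -xrowE !mxE !tpermL.
  have cU := glue m t _ (fun t => tperm_mx 0 t.1) omt.
  have cV := glue m t _ (fun t => tperm_mx 0 t.2) omt.
  exact: (congr_mulmx (congr_mulmx cU (congr_mx_refl m C)) cV).
exists (k * w); last by apply: maximal_notM => // /eq_m.
by exists (w *: C); rewrite -scalerA wM !scalerA mulrC -gk mulrC.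
Qed.

Definition diag_of (s : nat -> A) r d : 'M[A]_(r, d) :=
  \matrix_(i, j) (s i *+ (i == j :> nat)).

(** Smith normal form over the semilocal ring of fractions whose denominators are
    invertible modulo [a], with denominators cleared. The pivot [g] divides all
    entries that remain after the elimination, so recursion applies to their
    quotients by [g], and each diagonal entry divides the next one in A itself. *)
Lemma smith r d (M : 'M[A]_(r, d)) : exists U V s,
  [/\ S (\det U), S (\det V), U *m M *m V = diag_of s r d
    & forall i, exists c, s i.+1 = s i * c].
Proof.
elim: r d M => [|r IHr] [|d] M.
- exists 1%:M, 1%:M, (fun=> 0); rewrite !det1.
  split; try exact: unit_mod1; last by exists 0; rewrite mul0r.
  by apply/matrixP=> -[].
- exists 1%:M, 1%:M, (fun=> 0); rewrite !det1.
  split; try exact: unit_mod1; last by exists 0; rewrite mul0r.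
  by apply/matrixP=> -[].
- exists 1%:M, 1%:M, (fun=> 0); rewrite !det1.
  split; try exact: unit_mod1; last by exists 0; rewrite mul0r.
  by apply/matrixP=> i [].
have [U [V [e [C0 [SU SV Se eM]]]]] := pivot M.
set N := U *m M *m V in eM; set g := N 0 0 in eM.
pose C := U *m C0 *m V.
have eN : e *: N = g *: C.
  transitivity (U *m (e *: M) *m V); first by rewrite -scalemxAr -scalemxAl.
  by rewrite eM -scalemxAr -scalemxAl.
have nz_e := unit_mod_neq0 Se.
have [g0|nz_g] := EM (g = 0).
  exists U, V, (fun=> 0); split=> // [|_]; last by exists 0; rewrite mul0r.
  apply/matrixP=> i j; rewrite [RHS]mxE mul0rn -/N.
  by have /matrixP/(_ i j) := eN; rewrite g0 scale0r !mxE => /domA[].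
pose N' : 'M_(1 + r, 1 + d) := N; pose C' : 'M_(1 + r, 1 + d) := C.
pose x := ursubmx N'; pose y := dlsubmx N'; pose Q := drsubmx N'.
pose x' := ursubmx C'; pose y' := dlsubmx C'; pose Q' := drsubmx C'.
have ex : e *: x = g *: x'.
  apply/matrixP=> i j; have /matrixP/(_ (lshift r i) (rshift 1 j)) := eN.
  by rewrite !mxE.
have ey : e *: y = g *: y'.
  apply/matrixP=> i j; have /matrixP/(_ (rshift 1 i) (lshift d j)) := eN.
  by rewrite !mxE.
have eQ : e *: Q = g *: Q'.
  apply/matrixP=> i j; have /matrixP/(_ (rshift 1 i) (rshift 1 j)) := eN.
  by rewrite !mxE.
have defN : N' = block_mx g%:M x y Q.
  rewrite -[LHS]submxK; congr block_mx; apply/matrixP=> i j.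
  by rewrite !ord1 [LHS]mxE [LHS]mxE [RHS]mxE eqxx; congr (N _ _); apply: val_inj.
(* As [e] x = g x' and [e] y = g y', these clear the first row and column. *)
pose L := block_mx 1%:M 0 (- y') e%:M : 'M[A]_(1 + r).
pose R := block_mx 1%:M (- x') 0 e%:M : 'M[A]_(1 + d).
pose M2 := e *: Q' - y' *m x'.
have ey0 : - y' *m g%:M + e%:M *m y = 0.
  by rewrite mul_mx_scalar mul_scalar_mx ey scalerN addNr.
have LNR : L *m N' *m R = block_mx g%:M 0 0 (g *: M2).
  rewrite defN !mulmx_block ey0 !mul0mx !mul1mx !mulmx1 !addr0 !mulmx0 !addr0.
  congr block_mx; rewrite ?add0r //.
    by rewrite mul_scalar_mx mul_mx_scalar ex scalerN addNr.
  rewrite mul_scalar_mx mul_mx_scalar eQ scalerDr mulNmx scalerN scalemxAr ex.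
  by rewrite -scalemxAr /M2 scalerBr addrC !scalerA mulrC.
have [U2 [V2 [s [SU2 SV2 UMV2 s_dvd]]]] := IHr d M2.
pose U3 := block_mx 1%:M 0 0 U2 : 'M[A]_(1 + r).
pose V3 := block_mx 1%:M 0 0 V2 : 'M[A]_(1 + d).
exists (U3 *m L *m U), (V *m R *m V3), (fun i => if i is i'.+1 then g * s i' else g).
split.
- have dU3 : \det U3 = \det U2 by rewrite det_ublock det1 mul1r.
  have dL : \det L = e ^+ r by rewrite det_lblock det1 mul1r det_scalar.
  rewrite !det_mulmx dU3 dL.
  by apply/unit_modM/SU/unit_modM/unit_modX.
- have dV3 : \det V3 = \det V2 by rewrite det_ublock det1 mul1r.
  have dR : \det R = e ^+ d by rewrite det_ublock det1 mul1r det_scalar.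
  rewrite !det_mulmx dV3 dR.
  by apply/unit_modM/SV2/unit_modM/unit_modX.
- have -> : U3 *m L *m U *m M *m (V *m R *m V3) = U3 *m (L *m N' *m R) *m V3.
    by rewrite /N' /N !mulmxA.
  rewrite LNR !mulmx_block !mul0mx !mulmx0 !mul1mx !mulmx1 !addr0 !add0r.
  rewrite -scalemxAr -scalemxAl UMV2 mul0mx.
  apply/matrixP=> i j; rewrite !mxE.
  case: (@split_ordP 1 r i) => i' ->; rewrite !mxE.
    case: (@split_ordP 1 d j) => j' ->; rewrite !mxE ?ord1 //.
  case: (@split_ordP 1 d j) => j' ->; rewrite !mxE ?ord1 //.
  by rewrite -mulrnAr eqn_add2l.
case=> [|i]; first by exists (s 0%N).
by have [c ->] := s_dvd i; exists c; rewrite mulrA.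
Qed.

End Smith.

(** * Ideals of minors *)

Section Minors.
Variable A : comNzRingType.
Implicit Types (x c : A).

Definition minors r d k (M : 'M[A]_(r, d)) : ideal A :=
  span_submod (V := A^o) (is_minor k M).

Lemma span_min (V : lmodType A) (T : V -> Prop) (N : submod V) :
  (forall v, T v -> N v) -> forall v, span_submod T v -> N v.
Proof.
move=> TN _ [s [Ts ->]]; rewrite big_seq.
by apply: (big_ind (fun v => N v)) => [||t /Ts/TN Nt];
  [exact: submod0 | exact: submodD | exact: submodZ].
Qed.

Lemma span_mem (V : lmodType A) (T : V -> Prop) v : T v -> span_submod T v.
Proof.
move=> Tv; exists [:: (1, v)]; split; last by rewrite big_seq1 scale1r.
by move=> t; rewrite inE => /eqP->.
Qed.

Lemma increasing_rearrangement n r (phi : 'I_n -> 'I_r) : injective phi ->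
  exists (f : 'I_n -> 'I_r) (s : 'S_n),
    {homo f : i i' / (i < i')%N} /\ phi =1 f \o s.
Proof.
move=> inj_phi; pose B := [set phi i | i : 'I_n].
have cardB : #|B| = n by rewrite card_imset // card_ord.
pose f (i : 'I_n) : 'I_r := enum_val (cast_ord (esym cardB) i).
have Bphi i : phi i \in B by apply: imset_f.
pose s0 i : 'I_n := cast_ord cardB (enum_rank_in (Bphi i) (phi i)).
have fs0 i : f (s0 i) = phi i.
  by rewrite /f /s0 cast_ordK enum_rankK_in.
have inj_s0 : injective s0 by move=> i i' /(congr1 f); rewrite !fs0 => /inj_phi.
exists f, (perm inj_s0); split=> [i i' lt_ii'|i]; last by rewrite /= permE fs0.
have sortedB : sorted ltn (map val (enum B)).
  apply: (subseq_sorted ltn_trans) (iota_ltn_sorted 0 r).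
  rewrite -val_enum_ord; apply: map_subseq; rewrite [X in subseq _ X]enumT.
  exact: filter_subseq.
have f_nth (k : 'I_n) : nat_of_ord (f k) = nth 0%N (map val (enum B)) k.
  rewrite (nth_map (f k)) -?cardE ?cardB //.
  by rewrite [LHS]/(nat_of_ord (enum_val (cast_ord (esym cardB) k))) (enum_val_nth (f k)).
rewrite !f_nth; apply: (sorted_ltn_nth ltn_trans) => //;
  by rewrite inE size_map -cardE cardB.
Qed.

(** A selection of rows that is not increasing gives zero if it repeats a row, and
    otherwise a minor up to sign. *)
Lemma minors_select r d k (M : 'M[A]_(r, d)) (f : 'I_k -> 'I_r) (h : 'I_k -> 'I_d) :
  {homo h : i i' / (i < i')%N} -> minors k M (\det (mxsub f h M)).
Proof.
move=> incr_h; have [/injectiveP inj_f|] := boolP (injectiveb f).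
  have [f' [s [incr_f' def_f]]] := increasing_rearrangement inj_f.
  have -> : mxsub f h M = row_perm s (mxsub f' h M).
    by apply/matrixP=> i j; rewrite !mxE def_f.
  rewrite row_permE det_mulmx det_perm; apply/ideal_Ml/span_mem.
  by exists f', h.
case/injectivePn=> i [i' ne_i eq_f]; rewrite (determinant_alternate ne_i).
  exact: ideal_0.
by move=> j; rewrite !mxE eq_f.
Qed.

(** The Cauchy-Binet formula before terms with the same set of rows are collected;
    it suffices for membership in ideals of minors. *)
Lemma det_mulmx_expand n r (X : 'M[A]_(n, r)) (Y : 'M[A]_(r, n)) :
  \det (X *m Y) = \sum_(f : {ffun 'I_n -> 'I_r})
    (\prod_i X i (f i)) * \det (rowsub f Y).
Proof.
transitivity (\sum_(s : 'S_n) \sum_(f : {ffun 'I_n -> 'I_r})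
    (-1) ^+ s * \prod_i (X i (f i) * Y (f i) (s i))).
  apply: eq_bigr => s _; rewrite -big_distrr /=; congr (_ * _).
  rewrite -(bigA_distr_bigA (fun i k => X i k * Y k (s i))) /=.
  by apply: eq_bigr => i _; rewrite mxE.
rewrite exchange_big; apply: eq_bigr => f _ /=.
rewrite /determinant big_distrr /=; apply: eq_bigr => s _.
rewrite big_split /= mulrCA; congr (_ * (_ * _)).
by apply: eq_bigr => i _; rewrite mxE.
Qed.

Lemma minors_mull n r d k (X : 'M[A]_(n, r)) (M : 'M[A]_(r, d)) x :
  minors k (X *m M) x -> minors k M x.
Proof.
apply: span_min => _ [f [h [_ incr_h ->]]].
have -> : mxsub f h (X *m M) = rowsub f X *m colsub h M.
  by rewrite -mxsub_mul.
rewrite det_mulmx_expand; apply: ideal_sum => phi _; apply: ideal_Ml.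
by rewrite -mxsub_comp; apply: minors_select.
Qed.

Lemma minors_tr r d k (M : 'M[A]_(r, d)) x : minors k M^T x -> minors k M x.
Proof.
apply: span_min => _ [f [h [incr_f incr_h ->]]]; apply: span_mem.
by exists h, f; split=> //; rewrite -det_tr trmx_mxsub trmxK.
Qed.

Lemma minors_mulr n r d k (M : 'M[A]_(r, d)) (X : 'M[A]_(d, n)) x :
  minors k (M *m X) x -> minors k M x.
Proof.
rewrite -[M *m X]trmxK => /minors_tr; rewrite trmx_mul => /minors_mull.
exact: minors_tr.
Qed.

Lemma minors_scale r d k c (M : 'M[A]_(r, d)) x :
  minors k M x -> minors k (c *: M) (c ^+ k * x).
Proof.
have I0 : minors k (c *: M) (c ^+ k * 0) by rewrite mulr0; apply: ideal_0.
have ID y z : minors k (c *: M) (c ^+ k * y) -> minors k (c *: M) (c ^+ k * z) ->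
    minors k (c *: M) (c ^+ k * (y + z)) by rewrite mulrDr; apply: ideal_D.
have IZ b y : minors k (c *: M) (c ^+ k * y) ->
    minors k (c *: M) (c ^+ k * (b * y)) by rewrite mulrCA; apply: ideal_Ml.
apply: (@span_min A^o _ (@Submod A A^o _ I0 ID IZ)) => _ [f [h [incr_f incr_h ->]]].
apply: span_mem; exists f, h; split=> //.
by rewrite -detZ; congr determinant; apply/matrixP=> i j; rewrite !mxE.
Qed.

Lemma minors_scalar d k c : (k <= d)%N -> minors k (c%:M : 'M[A]_d) (c ^+ k).
Proof.
move=> le_kd; apply: span_mem.
exists (widen_ord le_kd), (widen_ord le_kd); split=> //.
by rewrite -det_scalar; congr determinant; apply/matrixP=> i j; rewrite !mxE.
Qed.

(** Without a strictly increasing choice of [k] rows the ideal would be zero. *)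
Lemma minors_le_rows r d k (M : 'M[A]_(r, d)) x :
  minors k M x -> x <> 0 -> (k <= r)%N.
Proof.
move=> [s [sP ->]] nz_x; case: s sP nz_x => [|t s] sP; first by rewrite big_nil.
have [f [h [incr_f _ _]]] := sP t (mem_head _ _).
have inj_f : injective f.
  move=> i i' eq_f; have [/incr_f|/incr_f|/ord_inj//] := ltngtP i i'.
    by rewrite eq_f ltnn.
  by rewrite eq_f ltnn.
by have := leq_card f inj_f; rewrite !card_ord.
Qed.

Section Diagonal.
Variable s : nat -> A.
Hypothesis s_dvd : forall i, exists c, s i.+1 = s i * c.

Lemma diag_dvd i i' : (i <= i')%N -> exists c, s i' = s i * c.
Proof.
elim: i' => [|i' IHi]; first by rewrite leqn0 => /eqP->; exists 1; rewrite mulr1.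
rewrite leq_eqVlt => /predU1P[->|/IHi[c e]]; first by exists 1; rewrite mulr1.
by have [c' ->] := s_dvd i'; exists (c * c'); rewrite e mulrA.
Qed.

(** Each term of the determinant is a multiple of the product of the [s (f i)] over
    the selected rows, and [f i] is at least [i] because [f] increases. *)
Lemma diag_minor_dvd r d k x :
  minors k (diag_of s r d) x -> exists c, x = (\prod_(i < k) s i) * c.
Proof.
apply: (@span_min A^o _ (principal _)) => _ [f [h [incr_f _ ->]]].
have le_f (i : 'I_k) : (i <= f i)%N.
  case: i => n; elim: n => [//|n IHn] lt_nk.
  by apply: leq_ltn_trans (IHn (ltnW lt_nk)) _; apply: incr_f.
have [c cP] := choice (fun i : 'I_k => diag_dvd (le_f i)).
apply: ideal_sum => t _; apply: ideal_Ml.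
exists (\prod_i (c i *+ (f i == h (t i) :> nat))).
rewrite -big_split /=; apply: eq_bigr => i _.
by rewrite !mxE cP mulrnAr.
Qed.

Lemma diag_minor r d k : (k <= r)%N -> (k <= d)%N ->
  minors k (diag_of s r d) (\prod_(i < k) s i).
Proof.
move=> le_kr le_kd; apply: span_mem.
exists (widen_ord le_kr), (widen_ord le_kd); split=> //.
transitivity (\det (diag_mx (\row_(i < k) s i))).
  by rewrite det_diag; apply: eq_bigr => i _; rewrite mxE.
by congr determinant; apply/matrixP=> i j; rewrite !mxE.
Qed.

End Diagonal.

End Minors.

(** * Cokernels and invariant factors *)

Section Isomorphisms.
Variable A : comNzRingType.

(** Both modules are the quotient of [V] by the common kernel. *)
Lemma lmod_iso_surj (V W X : lmodType A) (f : {linear V -> W}) (g : {linear V -> X}) :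
  (forall w, exists v, f v = w) -> (forall x, exists v, g v = x) ->
  (forall v, f v = 0 <-> g v = 0) -> lmod_iso W X.
Proof.
move=> /choice[s fs] /choice[t gt] ker.
have eq_fg v v' : f v = f v' <-> g v = g v'.
  have fB := linearB f v v'; have gB := linearB g v v'.
  split=> /eqP; rewrite -subr_eq0 => /eqP e; apply/eqP; rewrite -subr_eq0.
    by rewrite -gB; apply/eqP/ker; rewrite fB.
  by rewrite -fB; apply/eqP/ker; rewrite gB.
pose h w := g (s w).
have h_linear : linear h.
  by move=> a w w'; rewrite /h -linearP; apply/eq_fg; rewrite linearP !fs.
pose hL : {linear W -> X} := HB.pack h (GRing.isLinear.Build A W X *:%R h h_linear).
exists hL; exists (fun x => f (t x)) => [w|x].
  by rewrite -[RHS]fs; apply/eq_fg; rewrite gt.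
by rewrite -[RHS]gt; apply/eq_fg; rewrite fs.
Qed.

Section QuotProj.
Variables (V : lmodType A) (N : submod V).

Fact quot_proj_linear : linear (quot_proj N).
Proof. by move=> a v w; rewrite quot_projD quot_projZ. Qed.

HB.instance Definition _ :=
  GRing.isLinear.Build A V (quot_mod N) *:%R (quot_proj N) quot_proj_linear.

Lemma quot_proj_eq0 v : quot_proj N v = 0 <-> N v.
Proof. by rewrite -(linear0 (quot_proj N)) quot_projP subr0. Qed.

End QuotProj.

End Isomorphisms.

Section InvariantFactors.
Variables (A : comNzRingType) (a : A).
Implicit Types (x y p q e c : A).
Hypotheses (domA : no_zero_divisors A) (nz_a : a <> 0) (fin_a : finite_mod a).
Hypothesis nonunit_a : forall c, a * c <> 1.
Hypothesis local_div : forall (m : ideal A) x y, maximal m -> m a ->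
  exists2 w : A, ~ m w & (exists c, w * y = x * c) \/ (exists c, w * x = y * c).

Local Notation S := (unit_mod a).

Lemma unit_mod_expr k e : S e -> unit_mod (a ^+ k) e.
Proof.
move=> [c [r e1]]; elim: k => [|k [c' [r' IHk]]].
  by exists 0, 1; rewrite mulr0 add0r expr0 mulr1.
exists (c * (e * c' + a ^+ k * r') + a * r * c'), (r * r').
transitivity ((e * c + a * r) * (e * c' + a ^+ k * r')); last by rewrite e1 IHk mulr1.
by rewrite exprS; ring.
Qed.

(** The local-global principle: in an ideal that contains a power of [a], membership
    may be tested after multiplication by a denominator. *)
Lemma ideal_unit_mod (I : ideal A) k e x : I (a ^+ k) -> S e -> I (e * x) -> I x.
Proof.
move=> Ia /(unit_mod_expr k)[c [r e1]] Ix.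
have -> : x = c * (e * x) + a ^+ k * (r * x).
  by rewrite -[LHS]mul1r -e1; ring.
by apply: ideal_D; [apply: ideal_Ml | apply: ideal_Mr].
Qed.

Fact sat0 p : exists e c, S e /\ e * 0 = p * c.
Proof. by exists 1, 0; split; [exact: unit_mod1 | rewrite !mulr0]. Qed.

Fact satD p x y : (exists e c, S e /\ e * x = p * c) ->
  (exists e c, S e /\ e * y = p * c) -> exists e c, S e /\ e * (x + y) = p * c.
Proof.
move=> [e [c [Se ex]]] [e' [c' [Se' ey]]]; exists (e * e'), (e' * c + e * c').
split; first exact: unit_modM.
transitivity (e' * (e * x) + e * (e' * y)); first by ring.
by rewrite ex ey; ring.
Qed.

Fact satM p y x : (exists e c, S e /\ e * x = p * c) ->
  exists e c, S e /\ e * (y * x) = p * c.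
Proof. by move=> [e [c [Se ex]]]; exists e, (y * c); rewrite mulrCA ex mulrCA. Qed.

(** The elements of A that [p] divides in the ring of fractions with denominators
    invertible modulo [a]. *)
Definition sat p : ideal A := @Submod A A^o _ (sat0 p) (@satD p) (@satM p).

Lemma sat_mem p : sat p p.
Proof. by exists 1, 1; split; [exact: unit_mod1 | ring]. Qed.

Lemma sat_mul p q x y : sat p x -> sat q y -> sat (p * q) (x * y).
Proof.
move=> [e [c [Se ex]]] [e' [c' [Se' ey]]]; exists (e * e'), (c * c').
by split; [exact: unit_modM | rewrite mulrACA ex ey mulrACA].
Qed.

Lemma sat_dvd p c x : sat (p * c) x -> sat p x.
Proof. by move=> [e [y [Se ex]]]; exists e, (c * y); rewrite ex mulrA. Qed.

(** The complementary factor is the saturation of [c], written without division as the set of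
    [x] with [p * x] in the saturation of [p * c]. *)
Lemma sat_ideal_dvd p c : sat (p * c) a -> ideal_dvd (sat p) (sat (p * c)).
Proof.
move=> sat_a.
have I0 : sat (p * c) (p * 0) by rewrite mulr0; apply: ideal_0.
have ID x y : sat (p * c) (p * x) -> sat (p * c) (p * y) -> sat (p * c) (p * (x + y)).
  by rewrite mulrDr; apply: ideal_D.
have IM y x : sat (p * c) (p * x) -> sat (p * c) (p * (y * x)).
  by rewrite mulrCA; apply: ideal_Ml.
exists (@Submod A A^o _ I0 ID IM) => x; split.
  move=> [e [y [Se ex]]].
  apply: (@ideal_unit_mod _ 2 e) => //.
    apply: span_mem; exists a, a; split; [exact: sat_dvd sat_a | | by []].
    exact: ideal_Ml.
  apply: span_mem; exists p, (c * y); split; [exact: sat_mem | | by rewrite ex; ring].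
  by have : sat (p * c) (p * (c * y)) by rewrite mulrA; apply/ideal_Mr/sat_mem.
apply: (@span_min A A^o _ (sat (p * c))) => _ [u [v [[e [w [Se eu]]] [e' [w' [Se' ev]]] ->]]].
exists (e * e'), (w * w'); split; first exact: unit_modM.
transitivity ((e * u) * (e' * v)); first by ring.
rewrite eu; transitivity (w * (e' * (p * v))); first by ring.
by rewrite ev; ring.
Qed.

Section Presentation.
Variables (r d : nat) (M : 'M[A]_(r, d)) (Y : 'M[A]_(d, r)).
Hypothesis YM : Y *m M = a%:M.

Lemma minors_aX k : (k <= d)%N -> minors k M (a ^+ k).
Proof.
move=> le_kd; apply: (@minors_mull _ _ _ _ _ Y); rewrite YM.
exact: minors_scalar.
Qed.

Section Diagonalized.
Variables (U : 'M[A]_r) (V : 'M[A]_d) (s : nat -> A).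
Hypotheses (SU : S (\det U)) (SV : S (\det V)) (UMV : U *m M *m V = diag_of s r d).
Hypothesis s_dvd : forall i, exists c, s i.+1 = s i * c.

Local Notation p k := (\prod_(i < k) s i).

Lemma undo_diag : \adj U *m diag_of s r d *m \adj V = (\det U * \det V) *: M.
Proof.
rewrite -UMV !mulmxA mul_adj_mx -!mulmxA mul_mx_adj mul_scalar_mx mul_mx_scalar.
by rewrite scalerA.
Qed.

(** Both sides contain a power of [a], and they agree up to denominators because [U]
    and [V] are invertible up to denominators. *)
Lemma minors_sat k x : (k <= d)%N -> minors k M x <-> sat (p k) x.
Proof.
move=> le_kd; split=> [|[e [c [Se ex]]]].
  move=> /(minors_scale (\det U * \det V)); rewrite -undo_diag.
  move=> /minors_mulr/minors_mull/(diag_minor_dvd s_dvd)[c e].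
  by exists ((\det U * \det V) ^+ k), c; split=> //; apply/unit_modX/unit_modM.
have aX := minors_aX le_kd.
apply: (ideal_unit_mod aX Se); rewrite ex; apply: ideal_Mr.
have le_kr : (k <= r)%N by apply: minors_le_rows aX _; apply: domain_neq0X.
have := diag_minor s le_kr le_kd; rewrite -UMV.
by move=> /minors_mulr/minors_mull.
Qed.

(** The matrix a Id is a left multiple of [M], so after conjugation by [V] and up to
    a denominator it is a left multiple of the diagonal form, whose i-th column is
    divisible by [s i]. *)
Lemma sat_a i : (i < d)%N -> sat (s i) a.
Proof.
move=> lt_id; pose i0 := Ordinal lt_id; pose Z := \adj V *m Y *m \adj U.
exists (\det U * \det V * \det V), (\det V * \sum_(k < r) Z i0 k *+ (k == i :> nat)).
split; first by apply: unit_modM => //; apply: unit_modM.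
have e : (\det U * \det V * \det V * a)%:M = \det V *: (Z *m diag_of s r d).
  transitivity (Z *m diag_of s r d *m \adj V *m V); last first.
    by rewrite -mulmxA mul_adj_mx mul_mx_scalar.
  rewrite /Z -!mulmxA [X in _ *m (_ *m X)]mulmxA [X in _ *m (_ *m X)]mulmxA undo_diag.
  rewrite -scalemxAl -!scalemxAr mulmxA [X in _ = _ *: X]mulmxA -[X in _ *: (X *m _)]mulmxA YM.
  rewrite mul_mx_scalar -scalemxAl mul_adj_mx scalerA scale_scalar_mx.
  by congr (_ %:M); ring.
have /matrixP/(_ i0 i0) := e; rewrite mxE eqxx mulr1n => ->.
rewrite [LHS]mxE [X in _ * X]mxE mulrCA; congr (_ * _); rewrite mulr_sumr.
apply: eq_bigr => k _; rewrite [diag_of _ _ _ _ _]mxE.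
by case: eqP => [->|_]; rewrite ?mulr0n ?mulr0 // mulr1n mulrC.
Qed.

Lemma prod_diag_neq0 k : (k <= d)%N -> p k <> 0.
Proof.
move=> le_kd p0; have /(minors_sat _ le_kd)[e [c [Se]]] := minors_aX le_kd.
rewrite p0 mul0r; apply: domain_neq0M => //; last exact: domain_neq0X.
exact: (unit_mod_neq0 nonunit_a Se).
Qed.

Lemma prod_unit_mod (T : finType) (f : T -> A) :
  (forall t, S (f t)) -> S (\prod_t f t).
Proof.
by move=> Sf; apply: (big_ind S) => //; [exact: unit_mod1 | exact: unit_modM].
Qed.

Lemma row_submodP (v : 'rV[A]_d) : row_submod M v <-> exists w : 'rV_r, v = w *m M.
Proof.
have N0 : exists w : 'rV_r, 0 = w *m M :> 'rV[A]_d by exists 0; rewrite mul0mx.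
have ND (v1 v2 : 'rV[A]_d) : (exists w : 'rV_r, v1 = w *m M) ->
    (exists w : 'rV_r, v2 = w *m M) ->
    exists w : 'rV_r, v1 + v2 = w *m M.
  by move=> [w ->] [w' ->]; exists (w + w'); rewrite mulmxDl.
have NZ c (v1 : 'rV[A]_d) : (exists w : 'rV_r, v1 = w *m M) ->
    exists w : 'rV_r, c *: v1 = w *m M.
  by move=> [w ->]; exists (c *: w); rewrite -scalemxAl.
split; first apply: (@span_min _ _ _ (Submod N0 ND NZ)) => _ [i ->].
  by exists (delta_mx 0 i); rewrite rowE.
move=> [w ->]; rewrite mulmx_sum_row.
apply: (big_ind (fun v => row_submod M v)) => [||i _].
- exact: submod0.
- exact: submodD.
by apply/submodZ/span_mem; exists i.
Qed.

Lemma row_submod_unit_mod e (v : 'rV[A]_d) :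
  S e -> row_submod M (e *: v) -> row_submod M v.
Proof.
move=> [c [y e1]] /row_submodP[w ew]; apply/row_submodP.
exists (c *: w + y *: (v *m Y)).
rewrite mulmxDl -!scalemxAl -mulmxA YM -ew mul_mx_scalar !scalerA -scalerDl.
by rewrite [c * e]mulrC [y * a]mulrC e1 scale1r.
Qed.

(** Row vectors times [V] identify the cokernel of [M] with that of its diagonal
    form. *)
Lemma diag_cokernel (v : 'rV[A]_d) :
  row_submod M v <-> forall i : 'I_d, sat (s i) ((v *m V) 0 i).
Proof.
have diagE (z : 'rV_r) i : (z *m diag_of s r d) 0 i =
    s i * \sum_(k < r) z 0 k *+ (k == i :> nat).
  rewrite mxE mulr_sumr; apply: eq_bigr => k _.
  by rewrite mxE; case: eqP => [->|_]; rewrite ?mulr0n ?mulr0 // mulr1n mulrC.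
split=> [/row_submodP[w ->] i|sV].
  exists (\det U), (\sum_(k < r) (w *m \adj U) 0 k *+ (k == i :> nat)).
  split=> //; rewrite -diagE -UMV !mulmxA -[w *m _ *m U]mulmxA mul_adj_mx.
  by rewrite mul_mx_scalar -!scalemxAl [RHS]mxE.
have /choice[e eP] := sV; have [c cP] := choice eP.
pose E := \prod_i e i.
have le_dr : (d <= r)%N.
  by apply: minors_le_rows (minors_aX (leqnn d)) _; apply: domain_neq0X.
have SE : S E by apply: prod_unit_mod => i; case: (cP i).
apply: (row_submod_unit_mod (unit_modM SE SV)); apply/row_submodP.
pose z : 'rV_r := \row_k (if insub (val k) is Some i
  then (\prod_(j | j != i) e j) * c i else 0).
exists (\det V *: (z *m U)).
have zE : z *m diag_of s r d = E *: (v *m V).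
  apply/rowP=> i; rewrite diagE [RHS]mxE /E (bigD1 i) //= mulrAC.
  have [_ ->] := cP i; rewrite -mulrA; congr (_ * _).
  rewrite (bigD1 (widen_ord le_dr i)) //= eqxx mulr1n big1 ?addr0 => [|k ne_ki].
    by rewrite mxE /= valK mulrC.
  by rewrite -[_ == _ :> nat]/(k == widen_ord le_dr i) (negPf ne_ki).
rewrite -scalemxAl mulrC -scalerA; transitivity (z *m diag_of s r d *m \adj V).
  by rewrite zE -scalemxAl -mulmxA mul_mx_adj mul_mx_scalar !scalerA mulrC.
by rewrite -UMV !mulmxA -[LHS]mulmxA mul_mx_adj mul_mx_scalar.
Qed.

(** With p = s_0 ... s_(k-1), the two ideals of minors are the saturations of p s_k
    and of p. The second one is invertible: its product with its inverse contains a
    denominator and a power of [a], and these are comaximal. *)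
Lemma diag_frac_quot (F : fieldType) (j : {rmorphism A -> F}) k (x : F) :
  injective j -> (k < d)%N ->
  frac_of j (sat (s k)) x <-> frac_quot j (minors k.+1 M) (minors k M) x.
Proof.
move=> inj_j lt_kd; have le_kd := ltnW lt_kd; have ak := minors_aX le_kd.
have pS : p k.+1 = p k * s k by rewrite big_ord_recr.
have p_mem : minors k M (p k) by apply/(minors_sat _ le_kd); apply: sat_mem.
have nz_jp : j (p k) != 0.
  apply/eqP=> jp0; apply: (prod_diag_neq0 le_kd).
  by apply: inj_j; rewrite jp0 rmorph0.
split=> [[y [e [c [Se ey]]] ->]|[t [tP ->]]].
  have [e0 [c0 [Se0 e0a]]] := (minors_sat _ le_kd).1 ak.
  have [c1 [r1 e1]] := unit_mod_expr k Se0.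
  (* The element e0/p lies in the inverse of the ideal of k x k minors, as the single
     denominator [e0] of a^k serves for all elements of this ideal. The two terms
     express y as y (e0 c1 + a^k r1). *)
  exists [:: (y * p k * c1, j e0 / j (p k)); (y * r1 * a ^+ k, 1)].
  split; last first.
    have je1 : j e0 * j c1 + j (a ^+ k) * j r1 = 1.
      by rewrite -!rmorphM -rmorphD e1 rmorph1.
    rewrite big_cons big_seq1 /= mulr1 !rmorphM.
    transitivity (j y * (j e0 * j c1 + j (a ^+ k) * j r1)).
      by rewrite je1 mulr1.
    by field.
  move=> t; rewrite !inE => /orP[] /eqP-> /=.
    split.
      apply/(minors_sat _ lt_kd); apply: ideal_Mr; rewrite pS mulrC.
      by apply: sat_mul; [exists e, c | exact: sat_mem].
    move=> b /(minors_sat _ le_kd)[e2 [c2 [Se2 e2b]]].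
    have [c3 [r3 e3]] := unit_mod_expr k Se2.
    exists (e0 * c2 * c3 + c0 * r3 * b).
    apply: (mulIf nz_jp); rewrite -rmorphM.
    have <- : e0 * b = (e0 * c2 * c3 + c0 * r3 * b) * p k.
      transitivity (e0 * c3 * (e2 * b) + (e0 * a ^+ k) * (r3 * b)); last first.
        by rewrite e2b e0a; ring.
      by rewrite -[LHS]mulr1 -e3; ring.
    by rewrite rmorphM; field.
  split; last by move=> b _; exists b; rewrite mul1r.
  have -> : y * r1 * a ^+ k = r1 * (a ^+ k * y) by ring.
  apply/(minors_sat _ lt_kd)/ideal_Ml; rewrite pS.
  by apply: sat_mul; [apply/(minors_sat _ le_kd) | exists e, c].
rewrite big_seq; apply: big_ind => [|_ _ [y Dy ->] [z Dz ->]|[y z] /tP[/= ym zm]].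
- by exists 0; [exact: ideal_0 | rewrite rmorph0].
- by exists (y + z); [exact: ideal_D | rewrite rmorphD].
have /(minors_sat _ lt_kd) sy := ym; rewrite pS in sy.
have [y' ey'] := zm y ((minors_sat _ le_kd).2 (sat_dvd sy)).
have [q eq] := zm (p k) p_mem; have [e [c [Se ey]]] := sy.
exists y'; last by rewrite mulrC.
exists e, (q * c); split=> //; apply: inj_j.
rewrite rmorphM -ey'; transitivity (z * j (e * y)); first by rewrite rmorphM; ring.
rewrite ey !rmorphM; transitivity (z * j (p k) * (j (s k) * j c)); first by ring.
by rewrite eq; ring.
Qed.

Lemma diag_invariant_factors (W : lmodType A) (f : {linear 'rV[A]_d -> W}) :
  (forall w, exists v, f v = w) -> (forall v, f v = 0 <-> row_submod M v) ->
  invariant_factors W (fun i : 'I_d => sat (s i)).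
Proof.
move=> f_surj f_ker; split=> [i i' le_ii'|].
  have [c e] := diag_dvd s_dvd le_ii'; rewrite e; apply: sat_ideal_dvd.
  by rewrite -e; apply: sat_a.
pose X := prod_mod (fun i : 'I_d => quot_mod (sat (s i)) : lmodType A).
pose g (v : 'rV[A]_d) : X :=
  [ffun i : 'I_d => quot_proj (sat (s i)) ((v *m V) 0 i)].
have g_linear : linear g.
  move=> c v w; apply/ffunP=> i; rewrite !ffunE mulmxDl -scalemxAl !mxE.
  exact: linearP.
pose gL : {linear 'rV[A]_d -> X} :=
  HB.pack g (GRing.isLinear.Build A 'rV[A]_d X *:%R g g_linear).
apply: (@lmod_iso_surj _ _ _ _ f gL) => // [x|v].
  have [y yP] := choice (fun i => quot_proj_surj (x i)).
  have [c [t e1]] := SV.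
  exists (c *: (\row_i y i *m \adj V)); apply/ffunP=> i.
  rewrite ffunE -yP; apply/quot_projP.
  rewrite -scalemxAl -mulmxA mul_adj_mx mul_mx_scalar scalerA !mxE.
  have -> : c * \det V * y i - y i = a * - (t * y i).
    by rewrite -[X in _ - X]mul1r -e1; ring.
  exact/ideal_Mr/sat_a.
rewrite f_ker diag_cokernel; split=> [sV|/ffunP g0 i].
  by apply/ffunP=> i; rewrite !ffunE; apply/quot_proj_eq0.
by apply/quot_proj_eq0; have := g0 i; rewrite !ffunE.
Qed.

End Diagonalized.

(** All statements about [M] follow from its Smith form over the semilocal ring of
    fractions with denominators invertible modulo [a]: an ideal containing a power
    of [a] is determined by its extension to that ring. *)
Theorem cokernel_invariant_factors (F : fieldType) (j : {rmorphism A -> F})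
    (W : lmodType A) (f : {linear 'rV[A]_d -> W}) :
  injective j ->
  (forall w, exists v, f v = w) -> (forall v, f v = 0 <-> row_submod M v) ->
  exists D : 'I_d -> ideal A,
    (forall (i : 'I_d) (x : F),
      frac_of j (D i) x <-> frac_quot j (minors i.+1 M) (minors i M) x)
    /\ invariant_factors W D.
Proof.
move=> inj_j f_surj f_ker.
have [U [V [s [SU SV UMV s_dvd]]]] :=
  smith domA fin_a nonunit_a local_div M.
exists (fun i : 'I_d => sat (s i)); split=> [i x|].
  exact: diag_frac_quot SU SV UMV s_dvd _ _ _ _ inj_j (ltn_ord i).
exact: diag_invariant_factors SU SV UMV s_dvd _ _ f_surj f_ker.
Qed.

End Presentation.
End InvariantFactors.

(** * Algebraic dependence in function fields *)

Section AlgebraicDependence.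
Variables (Fq : finFieldType) (F : fieldType) (iota : {rmorphism Fq -> F}).

(** The function field is generated as a vector space by the [e l] over the field of
    fractions of the image of [ev], the evaluation of polynomials at an element. *)
Section Coordinates.
Variables (ev : {rmorphism {poly Fq} -> F}) (n : nat) (e : 'I_n -> F).
Hypothesis evC : forall c, ev c%:P = iota c.
Hypothesis gen_e : forall y : F, exists c : 'I_n -> F,
  (forall l, exists p r, ev r != 0 /\ c l = ev p / ev r) /\ y = \sum_l c l * e l.

Lemma clear_denominator y : exists r (P : 'I_n -> {poly Fq}),
  ev r != 0 /\ ev r * y = \sum_l ev (P l) * e l.
Proof.
have [c [c_rat ->]] := gen_e y.
have [p pP] := choice c_rat; have [r rP] := choice pP.
exists (\prod_l r l), (fun l => p l * \prod_(l' | l' != l) r l'); split.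
  by rewrite rmorph_prod; apply/prodf_neq0 => l _; case: (rP l).
rewrite mulr_sumr; apply: eq_bigr => l _; have [nz_r ->] := rP l.
by rewrite (bigD1 l) //= !rmorphM; field.
Qed.

Lemma common_denominator (T : finType) (y : T -> F) :
  exists r (P : T -> 'I_n -> {poly Fq}),
    ev r != 0 /\ forall t, ev r * y t = \sum_l ev (P t l) * e l.
Proof.
have [r rP] := choice (fun t => clear_denominator (y t)).
have [P PP] := choice rP.
exists (\prod_t r t), (fun t l => P t l * \prod_(t' | t' != t) r t'); split.
  by rewrite rmorph_prod; apply/prodf_neq0 => t _; case: (PP t).
move=> t; rewrite (bigD1 t) //= rmorphM mulrAC; have [_ ->] := PP t.
by rewrite mulr_suml; apply: eq_bigr => l _; rewrite rmorphM mulrAC.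
Qed.

(** The products of at most 2N factors [al] or [y] lie in a space over Fq whose
    dimension grows linearly in N, whereas there are N^2 monomials of degree less
    than N in each of [al] and [y]; two distinct combinations of these monomials
    must therefore agree. *)
Lemma algebraic_dependence_coord (al y : F) :
  exists N (c : {ffun 'I_N * 'I_N -> Fq}),
    c != [ffun=> 0] /\ \sum_t iota (c t) * (al ^+ t.1 * y ^+ t.2) = 0.
Proof.
pose be (o : option bool) := if o is Some b then if b then al else y else 1.
have [r1 [P1 [nz_r1 r1P]]] := clear_denominator 1.
have [r [Q [nz_r rQ]]] :=
  common_denominator (fun t : option bool * 'I_n => be t.1 * e t.2).
pose D0 := (\max_l size (P1 l))%N; pose D := (\max_t \max_l size (Q t l))%N.
(* Multiplication by 1, [al] or [y] maps [lat N] to [lat N.+1]; the factor 1 serves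
   to bring monomials of different degrees into the same [lat N]. *)
pose lat N z := exists P : 'I_n -> {poly Fq},
  (forall l, size (P l) <= N * D + D0)%N /\
  ev (r ^+ N * r1) * z = \sum_l ev (P l) * e l.
have lat0 : lat 0%N 1.
  exists P1; split=> [l|]; last by rewrite mul1r.
  exact: (leq_bigmax (F := fun l => size (P1 l))).
have lat_step o N z : lat N z -> lat N.+1 (be o * z).
  move=> [P [szP zP]].
  exists (fun k => \sum_l P l * Q (o, l) k); split=> [k|].
    apply: leq_trans (size_sum _ _ _) _; apply/bigmax_leqP => l _.
    apply: leq_trans (size_polyMleq _ _) _; apply: leq_trans (leq_pred _) _.
    rewrite mulSn -addnA addnC leq_add //.
    apply: leq_trans (leq_bigmax (F := fun t => \max_l size (Q t l))%N (o, l)).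
    exact: (leq_bigmax (F := fun k => size (Q (o, l) k))).
  transitivity (ev r * be o * (ev (r ^+ N * r1) * z)).
    by rewrite exprS !rmorphM; ring.
  rewrite zP mulr_sumr.
  transitivity (\sum_l \sum_k ev (P l * Q (o, l) k) * e k).
    apply: eq_bigr => l _.
    transitivity (ev (P l) * (ev r * (be o * e l))); first by ring.
    rewrite (rQ (o, l)) mulr_sumr.
    by apply: eq_bigr => k _; rewrite rmorphM mulrA.
  by rewrite exchange_big; apply: eq_bigr => k _; rewrite rmorph_sum mulr_suml.
have lat_iter o N z i : lat N z -> lat (i + N)%N (be o ^+ i * z).
  move=> latz; elim: i => [|i IHi]; first by rewrite mul1r.
  by rewrite exprS -mulrA addSn; apply: lat_step.
(* Large enough for n (2 N D + D0) < N^2. *)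
pose N := (n * (2 * D + D0)).+1.
have mono (t : 'I_N * 'I_N) : lat (2 * N)%N (al ^+ t.1 * y ^+ t.2).
  have := lat_iter (Some true) _ _ t.1 (lat_iter (Some false) _ _ t.2
    (lat_iter None _ _ ((N - t.1) + (N - t.2))%N lat0)).
  rewrite /= expr1n mulr1 mulr1 addn0.
  congr lat; have := ltnW (ltn_ord t.1); have := ltnW (ltn_ord t.2); lia.
have [P PP] := choice mono.
pose B := (2 * N * D + D0)%N.
pose Phi (c : {ffun 'I_N * 'I_N -> Fq}) : {ffun 'I_n * 'I_B -> Fq} :=
  [ffun lb : 'I_n * 'I_B => \sum_t c t * (P t lb.1)`_lb.2].
have /injectivePn[c1 [c2 ne_c eq_Phi]] : ~~ injectiveb Phi.
  apply/negP=> /injectiveP/leq_card; rewrite !card_ffun !card_prod !card_ord.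
  rewrite leq_exp2l ?finNzRing_gt1 // leqNgt => /negP; apply.
  rewrite /B {}/Phi {PP P mono}; rewrite /N; nia.
exists N, (c1 - c2); split.
  apply: contra ne_c => /eqP/ffunP e12; apply/eqP/ffunP => t.
  by have := e12 t; rewrite !ffunE => /eqP; rewrite subr_eq0 => /eqP.
have P0 l : \sum_t (c1 - c2) t *: P t l = 0.
  apply/polyP=> i; rewrite coef0 coef_sum.
  have [lt_iB|le_Bi] := ltnP i B.
    have /ffunP/(_ (l, Ordinal lt_iB)) := eq_Phi; rewrite !ffunE /= => /eqP.
    rewrite -subr_eq0 -sumrB => /eqP e12; rewrite -[RHS]e12.
    by apply: eq_bigr => t _; rewrite coefZ !ffunE mulrBl.
  rewrite big1 // => t _; rewrite coefZ nth_default ?mulr0 //.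
  by have [szP _] := PP t; apply: leq_trans (szP l) le_Bi.
have nz : ev (r ^+ (2 * N) * r1) != 0.
  by rewrite rmorphM rmorphXn mulf_neq0 ?expf_neq0.
apply: (mulfI nz); rewrite mulr0 mulr_sumr.
transitivity (\sum_t \sum_l ev ((c1 - c2) t *: P t l) * e l).
  apply: eq_bigr => t _; have [_ e_t] := PP t; rewrite mulrCA e_t mulr_sumr.
  apply: eq_bigr => l _; rewrite mulrA; congr (_ * _).
  by rewrite -mul_polyC rmorphM evC.
rewrite exchange_big big1 // => l _.
by rewrite -mulr_suml -rmorph_sum P0 rmorph0 mul0r.
Qed.

End Coordinates.

Lemma algebraic_dependence (al y : F) : function_field iota ->
  exists N (c : {ffun 'I_N * 'I_N -> Fq}),
    c != [ffun=> 0] /\ \sum_t iota (c t) * (al ^+ t.1 * y ^+ t.2) = 0.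
Proof.
move=> [[x [_ [n [e gen_e]]]] _].
pose ev : {rmorphism {poly Fq} -> F} := horner_eval x \o map_poly iota.
apply: (algebraic_dependence_coord (ev := ev) _ gen_e) => c.
by rewrite /= /horner_eval map_polyC hornerC.
Qed.

End AlgebraicDependence.

(** * Function rings *)

Section FiniteQuotients.
Variables (Fq : finFieldType) (A : comAlgType Fq).

Lemma horner_alg_poly (y : A) n (c : nat -> Fq) :
  horner_alg y (\poly_(i < n) c i) = \sum_(i < n) c i *: y ^+ i.
Proof.
rewrite poly_def rmorph_sum; apply: eq_bigr => i _.
by rewrite -mul_polyC rmorphM rmorphXn /= horner_algX horner_algC mulr_algl.
Qed.

(** Modulo [a] the powers of each generator reduce to bounded ones, so that finitely
    many monomials span A/(a) over Fq. *)
Lemma finite_mod_algebraic m (pi : {lrmorphism {mpoly Fq[m]} -> A}) (a : A) :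
  (forall y, exists p, pi p = y) ->
  (forall y, exists2 f : {poly Fq}, f != 0 & exists b, horner_alg y f = a * b) ->
  finite_mod a.
Proof.
move=> pi_surj algP; pose g k := pi 'X_k.
have algP' k : exists f, f != 0 /\ exists b, horner_alg (g k) f = a * b.
  by have [f nz_f fb] := algP (g k); exists f.
have [f fP] := choice algP'.
pose n := (\max_k size (f k))%N.
pose R (k : 'I_m) e : {poly Fq} := 'X^e %% f k.
have szR k e : (size (R k e) <= n)%N.
  have [nz_f _] := fP k; apply: leq_trans (ltnW _) (leq_bigmax k).
  by rewrite ltn_modp.
have powR k e : principal a (g k ^+ e - \sum_(i < n) (R k e)`_i *: g k ^+ i).
  have -> : \sum_(i < n) (R k e)`_i *: g k ^+ i = horner_alg (g k) (R k e).
    rewrite -horner_alg_poly; congr (horner_alg _ _); apply/polyP=> i.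
    rewrite coef_poly; case: ltnP => // le_ni.
    by rewrite nth_default // (leq_trans (szR k e)).
  have -> : g k ^+ e = horner_alg (g k) 'X^e by rewrite rmorphXn /= horner_algX.
  rewrite {1}(divp_eq 'X^e (f k)) rmorphD rmorphM addrK.
  have [_ [b fb]] := fP k; exists (horner_alg (g k) ('X^e %/ f k) * b).
  by rewrite mulrCA -fb.
pose G (h : {ffun 'I_m -> 'I_n}) := \prod_k g k ^+ h k.
pose X : finType := {ffun {ffun 'I_m -> 'I_n} -> Fq}.
pose val (c : X) := \sum_h c h *: G h.
exists X, val => y.
suff: exists c, principal a (y - val c).
  by move=> [c [b e]]; exists c, b; rewrite -e addrC subrK.
have [p <-] := pi_surj y; rewrite [p]mpolyE rmorph_sum /=.
apply: (big_ind (fun y => exists c, principal a (y - val c))).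
- exists [ffun=> 0]; rewrite /val big1 ?subrr; first exact: ideal_0.
  by move=> h _; rewrite ffunE scale0r.
- move=> y1 y2 [c1 e1] [c2 e2]; exists [ffun h => c1 h + c2 h].
  have -> : val [ffun h => c1 h + c2 h] = val c1 + val c2.
    by rewrite -big_split; apply: eq_bigr => h _; rewrite ffunE scalerDl.
  by rewrite opprD addrACA; apply: ideal_D.
move=> mo _; exists [ffun h : {ffun 'I_m -> 'I_n} => p@_mo * \prod_k (R k (mo k))`_(h k)].
have -> : val [ffun h : {ffun 'I_m -> 'I_n} => p@_mo * \prod_k (R k (mo k))`_(h k)]
    = p@_mo *: \prod_k \sum_(i < n) (R k (mo k))`_i *: g k ^+ i.
  rewrite bigA_distr_bigA scaler_sumr; apply: eq_bigr => h _.
  by rewrite ffunE -scalerA scaler_prod.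
rewrite linearZZ -scalerBr -mulr_algl; apply: ideal_Ml.
rewrite mpolyXE_id rmorph_prod.
apply: (big_ind2 (fun y z => principal a (y - z))) => [||k _].
- by rewrite subrr; apply: ideal_0.
- by move=> *; apply: congr_mul.
by rewrite rmorphXn; apply: powR.
Qed.

End FiniteQuotients.

Section FunctionRings.
Variables (Fq : finFieldType) (F : fieldType) (iota : {rmorphism Fq -> F}).
Variables (A : comAlgType Fq) (j : {rmorphism A -> F}).
Hypotheses (inj_j : injective j) (j_const : forall c, j c%:A = iota c).

Lemma subring_domain : no_zero_divisors A.
Proof.
move=> x y xy0; have /eqP : j x * j y = 0 by rewrite -rmorphM xy0 rmorph0.
rewrite mulf_eq0 -(rmorph0 j) => /orP[] /eqP/inj_j; by [left | right].
Qed.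

(** Divide an algebraic relation between [a] and [y] by the largest power of [a]
    that divides all its terms, and reduce modulo [a]. *)
Lemma algebraic_mod (hF : function_field iota) (a y : A) : a <> 0 ->
  exists2 f : {poly Fq}, f != 0 & exists b, horner_alg y f = a * b.
Proof.
move=> nz_a; have [N [c [nz_c]]] := algebraic_dependence (j a) (j y) hF.
have [t0 nz_t0] : exists t, c t != 0.
  by apply: contrapT => c0; case/eqP: nz_c; apply/ffunP => t; rewrite ffunE;
    apply/eqP/negPn/negP => ct; case: c0; exists t.
pose f i : {poly Fq} := \poly_(k < N) (if insub i is Some i' then
  if insub k is Some k' then c (i', k') else 0 else 0).
have fE (i : 'I_N) : horner_alg y (f i) = \sum_(k < N) c (i, k) *: y ^+ k.
  by rewrite horner_alg_poly; apply: eq_bigr => k _; rewrite !valK.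
have nz_f : exists i, f i != 0.
  exists t0.1; apply/eqP=> /(congr1 (fun p : {poly Fq} => p`_t0.2)).
  by rewrite coef0 coef_poly ltn_ord !valK -surjective_pairing; apply/eqP.
have f_lt i : f i != 0 -> (i < N)%N.
  rewrite ltnNge; apply: contra => le_Ni; apply/eqP/polyP => k.
  rewrite coef_poly coef0 insubF ?if_same //.
  by apply/negbTE; rewrite -leqNgt.
move=> rel.
have relA : \sum_(i < N) a ^+ i * horner_alg y (f i) = 0.
  apply: inj_j; rewrite rmorph0 -rel rmorph_sum.
  transitivity (\sum_(i < N) \sum_(k < N) iota (c (i, k)) * (j a ^+ i * j y ^+ k)).
    apply: eq_bigr => i _; rewrite fE rmorphM rmorph_sum mulr_sumr.
    apply: eq_bigr => k _.
    by rewrite -mulr_algl rmorphM j_const !rmorphXn mulrCA.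
  by rewrite pair_bigA; apply: eq_bigr => -[].
case: (ex_minnP nz_f) => i0 nz_i0 min_i0; exists (f i0) => //.
have lt_i0 := f_lt _ nz_i0.
pose b := \sum_(i < N | (i0 < i)%N) a ^+ (i - i0.+1) * horner_alg y (f i).
exists (- b).
apply: (domain_cancel subring_domain
  (domain_neq0X (n := i0) subring_domain nz_a)).
apply/eqP; rewrite mulrN mulrN -subr_eq0 opprK; apply/eqP; rewrite -relA.
rewrite (bigD1 (Ordinal lt_i0)) //=; congr (_ + _).
rewrite [RHS](bigID (fun i : 'I_N => (i0 < i)%N)) /= [X in _ + X]big1 ?addr0.
  rewrite mulrA -exprSr mulr_sumr; apply: eq_big => [i|i lt_i].
    rewrite andbC; case: ltnP => //= lt_i; apply/esym/eqP => e.
    by rewrite e ltnn in lt_i.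
  by rewrite mulrA -exprD subnKC.
move=> i /andP[ne_i]; rewrite -leqNgt leq_eqVlt => /predU1P[e|lt_i].
  by case/eqP: ne_i; apply: val_inj.
have -> : f i = 0 by apply/eqP/negPn/negP => /min_i0; rewrite leqNgt lt_i.
by rewrite rmorph0 mulr0.
Qed.

Section ValuationRing.
Variable O : F -> Prop.
Hypothesis ptO : closed_point iota O.

Lemma valuation1 : O 1.
Proof. by case: ptO => Oc _ _ _; rewrite -(rmorph1 iota). Qed.

Lemma valuationM x y : O x -> O y -> O (x * y).
Proof. by case: ptO => _ OB _ _ Ox Oy; case: (OB x y Ox Oy). Qed.

Lemma valuation0 : O 0.
Proof. by case: ptO => Oc _ _ _; rewrite -(rmorph0 iota). Qed.

Lemma valuationD x y : O x -> O y -> O (x + y).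
Proof.
case: ptO => _ OB _ _ Ox Oy; have [ONy _] := OB _ _ valuation0 Oy.
by have [] := OB _ _ Ox ONy; rewrite sub0r opprK.
Qed.

(** The fractional ideal of a valuation ring generated by finitely many elements is
    generated by one of them. *)
Lemma valuation_dominant (T : finType) (z : T -> F) t0 : z t0 != 0 ->
  exists2 t, z t != 0 & forall t', O (z t' / z t).
Proof.
move=> nz0; suff [t nz_t tP] : exists2 t, z t != 0 &
    forall t', t' \in enum T -> O (z t' / z t).
  by exists t => // t'; apply: tP; rewrite mem_enum.
elim: (enum T) => [|t1 s [t nz_t tP]]; first by exists t0.
have [Ot|nO] := EM (O (z t1 / z t)).
  by exists t => // t'; rewrite inE => /predU1P[->|/tP].
have nz1 : z t1 != 0 by apply/eqP=> z0; apply: nO; rewrite z0 mul0r; apply: valuation0.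
exists t1 => // t'; rewrite inE => /predU1P[->|/tP Ot'].
  by rewrite divff //; apply: valuation1.
have -> : z t' / z t1 = (z t' / z t) * (z t / z t1) by field; apply/andP.
apply: valuationM => //; case: ptO => _ _ _ Oinv.
by have [||] := Oinv (z t1 / z t); rewrite ?mulf_neq0 ?invr_neq0 // invf_div.
Qed.

End ValuationRing.

(** A valuation ring O that contains A contains the stabilizer in F of a nonzero
    ideal, because the O-module that this ideal spans is generated by one of its
    elements. *)
Lemma function_ring_closed (Oinf : F -> Prop) :
  (forall x, (exists a : A, j a = x) <-> regular_outside iota Oinf x) ->
  (forall a : A, a <> 0 -> finite_mod a) -> ideally_closed A.
Proof.
move=> regA finA m a b ma nz_a stab.
have nz_ja : j a != 0 by apply/eqP=> ja0; apply: nz_a; apply: inj_j; rewrite ja0 rmorph0.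
suff /regA[c jc] : regular_outside iota Oinf (j b / j a).
  by exists c; apply: inj_j; rewrite rmorphM jc mulrCA divff ?mulr1.
move=> O ptO neO.
have OA c : O (j c) by apply: (regA (j c)).1 => //; exists c.
have [X [val valP]] := finA a nz_a.
pose z (t : option X) := if t is Some c then
  if `[< m (val c) >] then j (val c) else 0 else j a.
have [t nz_t tP] := valuation_dominant (z := z) ptO (t0 := None) nz_ja.
have [n mn zn] : exists2 n, m n & z t = j n.
  move: nz_t; rewrite /z; case: t {tP} => [c|]; last by exists a.
  by case: asboolP => [mc|_]; [exists (val c) | rewrite eqxx].
rewrite zn in nz_t tP.
have domn x : m x -> O (j x / j n).
  move=> mx; have [c [d e]] := valP x.
  have mc : m (val c).
    have -> : val c = x - a * d by rewrite e addrK.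
    by apply/ideal_B/ideal_Mr.
  rewrite e rmorphD rmorphM mulrDl; apply: valuationD => //.
    by have := tP (Some c); rewrite /z asboolT.
  by rewrite mulrAC; apply: valuationM => //; apply: (tP None).
have [y my e] := stab n mn.
have -> : j b / j a = j y / j n.
  by apply/eqP; rewrite eqr_div // -!rmorphM e mulrC.
exact: domn.
Qed.

End FunctionRings.

(** * The module of rational points of the kernel *)

Section KernelPresentation.
Variables (Fq : finFieldType) (A : comAlgType Fq) (K : fieldExtType Fq).
Variables (gamma : {lrmorphism A -> K}) (phi psi : drinfeld_module gamma).
Variables (u : ore K) (hu : drinfeld_morphism phi psi u).
Variables (d : nat) (b : d.-tuple K).
Hypothesis hb : basis_of (kerK u) b.

Local Notation W := (ker_module hu).
Local Notation rho a := (action_mx phi b a).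
Local Notation cst := (in_alg A).

Lemma basis_in_kerK (i : 'I_d) : b`_i \in kerK u.
Proof. by apply: (basis_mem hb); rewrite mem_nth ?size_tuple. Qed.

Definition basis_vec (i : 'I_d) : W := Subvs (basis_in_kerK i).

Lemma ker_val_sum (I : finType) (G : I -> W) :
  vsval (\sum_i G i) = \sum_i vsval (G i).
Proof. exact: (linear_sum (vsval (U := kerK u))). Qed.

Lemma ker_val_const c (z : W) : vsval (c%:A *: z) = c *: vsval z.
Proof.
rewrite val_ker_scale linearZZ rmorph1.
rewrite /ore_eval -[c *: 1]/(oreC c%:A * oreC 1) mulr1 ore_evalC.
by rewrite mulr_algl.
Qed.

Lemma ker_coord (z : W) : z = \sum_l (coord b l (vsval z))%:A *: basis_vec l.
Proof.
apply: val_inj; rewrite /= ker_val_sum {1}(coord_basis hb (subvsP z)).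
by apply: eq_bigr => l _; rewrite ker_val_const.
Qed.

Lemma ker_coord_inj (c c' : 'I_d -> Fq) :
  \sum_l (c l)%:A *: basis_vec l = \sum_l (c' l)%:A *: basis_vec l -> c =1 c'.
Proof.
move=> /(congr1 (@vsval _ _ (kerK u))); rewrite !ker_val_sum => e l.
have val_c (h : 'I_d -> Fq) :
    coord b l (\sum_l vsval ((h l)%:A *: basis_vec l : W)) = h l.
  under eq_bigr do rewrite ker_val_const.
  exact/coord_sum_free/(basis_free hb).
by rewrite -(val_c c) -(val_c c') e.
Qed.

Lemma action_basis a i : a *: basis_vec i = \sum_l (rho a i l)%:A *: basis_vec l.
Proof. by rewrite [LHS]ker_coord; apply: eq_bigr => l _; rewrite mxE. Qed.

Lemma action_mx_eq a (R : 'M[Fq]_d) :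
  (forall i, a *: basis_vec i = \sum_l (R i l)%:A *: basis_vec l) -> rho a = R.
Proof.
move=> RP; apply/matrixP=> i l; apply: (ker_coord_inj (c := rho a i) (c' := R i)).
by rewrite -action_basis RP.
Qed.

Lemma action_mxM a c : rho (a * c) = rho a *m rho c.
Proof.
apply: action_mx_eq => i; rewrite mulrC -scalerA action_basis scaler_sumr.
transitivity (\sum_l \sum_k (rho a i l * rho c l k)%:A *: basis_vec k).
  apply: eq_bigr => l _; rewrite scalerA mulrC -scalerA action_basis scaler_sumr.
  by apply: eq_bigr => k _; rewrite scalerA -!in_algE rmorphM.
rewrite exchange_big; apply: eq_bigr => k _.
by rewrite -scaler_suml mxE -!in_algE rmorph_sum.
Qed.

Lemma action_mxD a c : rho (a + c) = rho a + rho c.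
Proof.
apply: action_mx_eq => i; rewrite scalerDl !action_basis -big_split.
by apply: eq_bigr => l _; rewrite [(rho a + rho c) i l]mxE !scalerDl.
Qed.

Lemma action_mx_const c : rho c%:A = c%:M.
Proof.
apply: action_mx_eq => i; rewrite (bigD1 i) //= mxE eqxx big1 ?addr0 // => l ne_l.
by rewrite mxE eq_sym (negPf ne_l) scale0r scale0r.
Qed.

(** A^d -> W, sending the unit vectors to the basis of the kernel. *)
Definition presentation_map (v : 'rV[A]_d) : W := \sum_i v 0 i *: basis_vec i.

Fact presentation_map_linear : linear presentation_map.
Proof.
move=> a v w; rewrite /presentation_map scaler_sumr -big_split.
by apply: eq_bigr => i _; rewrite !mxE scalerDl scalerA.
Qed.

HB.instance Definition _ :=
  GRing.isLinear.Build A 'rV[A]_d W *:%R presentation_map presentation_map_linear.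

Lemma presentation_map_surj w : exists v, presentation_map v = w.
Proof.
exists (\row_l (coord b l (vsval w))%:A); rewrite [RHS]ker_coord.
by apply: eq_bigr => l _; rewrite mxE.
Qed.

Variables (m : nat) (pi : {lrmorphism {mpoly Fq[m]} -> A}).
Hypothesis pi_surj : forall a, exists p, pi p = a.

Local Notation g k := (pi 'X_k).
Local Notation Mchi := (char_mx (fun k => g k) (fun k => rho (g k))).

(** The elements [a] for which a Id - rho(a) is a left multiple of the
    characteristic matrix form a subalgebra, and it contains the generators. *)
Lemma char_mx_generates a : exists X, a%:M - map_mx cst (rho a) = X *m Mchi.
Proof.
have [p <-] := pi_surj a.
have good_const c : exists X, (c%:A)%:M - map_mx cst (rho c%:A) = X *m Mchi.
  exists 0; rewrite mul0mx action_mx_const map_scalar_mx /=; exact: subrr.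
have goodD x y : (exists X, x%:M - map_mx cst (rho x) = X *m Mchi) ->
    (exists X, y%:M - map_mx cst (rho y) = X *m Mchi) ->
    exists X, (x + y)%:M - map_mx cst (rho (x + y)) = X *m Mchi.
  move=> [X eX] [Y eY]; exists (X + Y).
  by rewrite mulmxDl -eX -eY action_mxD map_mxD raddfD opprD addrACA.
have goodM x y : (exists X, x%:M - map_mx cst (rho x) = X *m Mchi) ->
    (exists X, y%:M - map_mx cst (rho y) = X *m Mchi) ->
    exists X, (x * y)%:M - map_mx cst (rho (x * y)) = X *m Mchi.
  move=> [X eX] [Y eY]; exists (y *: X + map_mx cst (rho x) *m Y).
  rewrite mulmxDl -scalemxAl -mulmxA -eX -eY action_mxM map_mxM mulmxBr.
  rewrite scalerBr scale_scalar_mx mul_mx_scalar addrA subrK.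
  by rewrite mulrC.
have goodX k : exists X, (g k)%:M - map_mx cst (rho (g k)) = X *m Mchi.
  exists (\mxrow_i (if i == k then 1%:M else 0)).
  rewrite /char_mx mul_mxrow_mxcol (bigD1 k) //= eqxx mul1mx big1 ?addr0 //.
  by move=> i /negPf->; rewrite mul0mx.
rewrite [p]mpolyE rmorph_sum.
apply: (big_ind (fun y => exists X, y%:M - map_mx cst (rho y) = X *m Mchi)) => [||mo _].
- by have := good_const 0; rewrite scale0r.
- exact: goodD.
rewrite -mul_mpolyC rmorphM; apply: (goodM _ _).
  by have := good_const p@_mo; rewrite -(rmorph1 pi) -linearZZ -alg_mpolyC.
rewrite mpolyXE_id rmorph_prod.
apply: (big_ind (fun y => exists X, y%:M - map_mx cst (rho y) = X *m Mchi)) => [||k _].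
- by have := good_const 1; rewrite scale1r.
- exact: goodM.
rewrite rmorphXn; elim: (mo k) => [|e IHe].
  by have := good_const 1; rewrite scale1r.
by rewrite exprS; apply: goodM IHe; apply: goodX.
Qed.

Lemma presentation_map_row (a : A) i :
  presentation_map (row i (a%:M - map_mx cst (rho a))) = 0.
Proof.
rewrite /presentation_map.
transitivity (\sum_l ((a *+ (i == l)) *: basis_vec l - (rho a i l)%:A *: basis_vec l)).
  by apply: eq_bigr => l _; rewrite !mxE scalerBl.
rewrite sumrB -action_basis (bigD1 i) //= eqxx big1 ?addr0 ?subrr // => l ne_l.
by rewrite eq_sym (negPf ne_l) scale0r.
Qed.

Lemma presentation_map_const (c : 'rV[Fq]_d) :
  presentation_map (map_mx cst c) = \sum_l (c 0 l)%:A *: basis_vec l.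
Proof. by apply: eq_bigr => l _; rewrite mxE. Qed.

(** Modulo the rows of the characteristic matrix every vector is congruent to one
    with entries in Fq, and the presentation map is injective on those. *)
Lemma presentation_map_ker v : presentation_map v = 0 <-> row_submod Mchi v.
Proof.
have rows_ker : forall v, row_submod Mchi v -> presentation_map v = 0.
  have I0 : presentation_map 0 = 0 by exact: linear0.
  have ID x y : presentation_map x = 0 -> presentation_map y = 0 ->
      presentation_map (x + y) = 0.
    by move=> ex ey; rewrite -[RHS]addr0 -{1}ex -{1}ey; apply: linearD.
  have IZ c x : presentation_map x = 0 -> presentation_map (c *: x) = 0.
    by move=> ex; rewrite -[RHS](scaler0 _ c) -{1}ex; apply: linearZZ.
  apply: (@span_min _ _ _ (Submod I0 ID IZ)) => _ [i ->].
  by rewrite row_mxcol; apply: presentation_map_row.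
split=> [v0|]; last exact: rows_ker.
have [X XP] := choice (fun i => char_mx_generates (v 0 i)).
pose w := \sum_i row i (X i); pose c := \sum_i row i (rho (v 0 i)).
have def_v : v = w *m Mchi + map_mx cst c.
  rewrite mulmx_suml map_mx_sum -big_split; apply/rowP=> l.
  rewrite summxE (bigD1 l) //= -!row_mul -XP.
  rewrite map_row -raddfD subrK !mxE eqxx big1 ?addr0 // => i ne_il.
  by rewrite -row_mul -XP map_row -raddfD subrK !mxE (negPf ne_il).
have w0 : row_submod Mchi (w *m Mchi) by apply/row_submodP; exists w.
have c0 : c = 0.
  apply/rowP=> l; rewrite [RHS]mxE.
  apply: (ker_coord_inj (c := c 0) (c' := fun=> 0)).
  rewrite -presentation_map_const [RHS]big1 => [|k _]; last by rewrite !scale0r.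
  have : presentation_map v =
      presentation_map (w *m Mchi) + presentation_map (map_mx cst c).
    by rewrite {1}def_v; apply: linearD.
  by rewrite v0 (rows_ker _ w0) add0r => <-.
by rewrite def_v c0 map_mx0 addr0.
Qed.

End KernelPresentation.

Theorem mainTheorem3
    (Fq : finFieldType)
    (F : fieldType) (iota : {rmorphism Fq -> F}) (hF : function_field iota)
    (Oinf : F -> Prop) (hOinf : closed_point iota Oinf)
    (A : comAlgType Fq) (j : {rmorphism A -> F})
    (hA : function_ring iota Oinf j)
    (m : nat) (P : {mpoly Fq[m]}) (pi : {lrmorphism {mpoly Fq[m]} -> A})
    (hpi : presentation P pi)
    (K : fieldExtType Fq) (gamma : {lrmorphism A -> K})
    (phi psi : drinfeld_module gamma) (u : ore K)
    (hu : drinfeld_morphism phi psi u)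
    (b : (\dim (kerK u)).-tuple K) (hb : basis_of (kerK u) b) :
  let d := \dim (kerK u) in
  let g (k : 'I_m) : A := pi 'X_k in
  let Mchi := char_mx g (fun k => action_mx phi b (g k)) in
  let Fitt := fitting Mchi in
  lmod_iso (ker_module hu) (quot_mod (row_submod Mchi)) /\
  (forall i : nat, (i <= d)%N -> exists2 a, Fitt i a & a != 0) /\
  (* D i is the (i+1)-st ideal of the chain, as ordinals start at 0 *)
  (exists D : 'I_d -> ideal A,
     (forall (i : 'I_d) (x : F),
        frac_of j (D i) x <-> frac_quot j (Fitt (d - i.+1)%N) (Fitt (d - i)%N) x)
     /\ invariant_factors (ker_module hu) D).
Proof.
case: hA => inj_j j_const regA; case: hpi => pi_surj _.
move=> d g Mchi Fitt.
have ker_f := presentation_map_ker hu hb pi_surj.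
have surj_f w : exists v, presentation_map hu hb v = w := presentation_map_surj hb w.
split.
  apply: (@lmod_iso_surj _ _ _ _ (presentation_map hu hb) (quot_proj (row_submod Mchi))).
  - exact: surj_f.
  - exact: quot_proj_surj.
  by move=> v; rewrite quot_proj_eq0; apply: ker_f.
have domA := subring_domain inj_j.
have finA (a : A) : a <> 0 -> finite_mod a.
  move=> nz_a; apply: (finite_mod_algebraic pi_surj) => y.
  exact: (algebraic_mod inj_j j_const hF).
have closedA : ideally_closed A by exact: (@function_ring_closed _ _ _ _ _ inj_j _ regA finA).
(* If A were Fq, the image of phi would consist of constants. As Fq is algebraically
   closed in F, this [t] is transcendental. *)
have [t t_nonconst] : exists t : A, ~ exists c : Fq, t = c%:A.
  apply: contrapT => no_t; case: (drinfeld_nonconst (d := phi)) => a.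
  have [[c ->]|a_nc] := EM (exists c : Fq, a = c%:A); last by case: no_t; exists a.
  exists c%:A; rewrite linearZZ rmorph1.
  by rewrite -[LHS]/(oreC c%:A * oreC 1) mulr1.
(* Two powers of [t] act in the same way on the kernel and on K; their difference
   kills the kernel, and it is not a unit because gamma kills it. *)
have [a [nz_a rho_a gamma_a]] : exists a : A,
    [/\ a <> 0, action_mx phi b a = 0 & gamma a = 0].
  pose h (i : nat) :=
    (action_mx phi b (t ^+ i), gamma (t ^+ i) : finvect_type K).
  have [i [k [lt_ik eq_h]]] : exists i k, (i < k)%N /\ h i = h k.
    have /injectivePn[i [k ne_ik eq_h]] :
        ~~ injectiveb (fun i : 'I_#|{: 'M[Fq]_d * finvect_type K}|.+1 => h i).
      by apply/negP=> /injectiveP/leq_card; rewrite card_ord ltnn.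
    have := ne_ik; rewrite neq_ltn => /orP[] lt_ik; first by exists i, k.
    by exists k, i.
  have eq_rho := congr1 fst eq_h.
  have eq_gamma : gamma (t ^+ i) = gamma (t ^+ k) := congr1 snd eq_h.
  exists (t ^+ k - t ^+ i); split; last first.
  - by rewrite rmorphB; apply/eqP; rewrite subr_eq0; apply/eqP/esym.
  - have : action_mx phi b (t ^+ k - t ^+ i + t ^+ i) = action_mx phi b (t ^+ i).
      by rewrite subrK; apply: esym.
    by rewrite (action_mxD hu hb) => /eqP; rewrite -subr_eq0 addrK => /eqP.
  move=> eq_t; apply: t_nonconst.
  have [|c jt] := hF.2 (j t); last by exists c; apply: inj_j; rewrite j_const.
  exists ('X^k - 'X^i).
    rewrite subr_eq0; apply/eqP=> /(congr1 (fun p : {poly Fq} => size p)).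
    by rewrite !size_polyXn => -[e]; rewrite e ltnn in lt_ik.
  rewrite /root rmorphB /= !map_polyXn hornerD hornerN !hornerXn.
  by rewrite -!rmorphXn -rmorphB eq_t rmorph0.
have nonunit_a c : a * c <> 1.
  move=> ac1; have : gamma a * gamma c = 1 by rewrite -rmorphM ac1 rmorph1.
  by rewrite gamma_a mul0r => /esym/eqP; rewrite oner_eq0.
have [Y YM] := char_mx_generates hu hb pi_surj a.
rewrite rho_a map_mx0 subr0 in YM.
have local_div (m0 : ideal A) (x y : A) : maximal m0 -> m0 a ->
    exists2 w : A, ~ m0 w & (exists c, w * y = x * c) \/ (exists c, w * x = y * c).
  exact: local_divisibility.
split=> [i le_id|].
  exists (a ^+ (d - i)); last exact/eqP/domain_neq0X.
  by apply: (minors_aX (esym YM)); apply: leq_subr.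
have [D [DP D_inv]] := cokernel_invariant_factors domA nz_a (finA a nz_a)
  nonunit_a local_div (esym YM) inj_j surj_f ker_f.
exists D; split=> // i x; rewrite DP /Fitt /fitting.
by rewrite !subKn // ltnW.
Qed.
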